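(* Let $\mathcal C$ be a class of topological semigroups such that $\mathsf{T_{z}S}\subseteq\mathcal C\subseteq\mathsf{T_{2}S}$. For a commutative semigroup $X$ the following conditions are equivalent: (1) $X$ is absolutely $\mathcal C$-closed; (2) $X$ is projectively $\mathcal C$-closed and injectively $\mathcal C$-closed; (3) $X$ is bounded, chain-finite, group-finite and Clifford+finite.
   Context: A topological semigroup is a topological space endowed with a continuous associative binary operation. $\mathsf{T_{2}S}$ is the class of Hausdorff topological semigroups; $\mathsf{T_{z}S}$ is the class of Hausdorff zero-dimensional topological semigroups, where a space is zero-dimensional if it has a base of clopen sets. A semigroup $X$, endowed with the discrete topology, is called: - $\mathcal C$-closed if for every isomorphic topological embedding $h:X\to Y$ (an injective homomorphism that is a homeomorphism onto its image) to a topological semigroup $Y\in\mathcal C$ the image $h[X]$ is closed in $Y$; - injectively $\mathcal C$-closed if for every injective homomorphism $h:X\to Y$ to a topological semigroup $Y\in\mathcal C$ the image $h[X]$ is closed in $Y$; - absolutely $\mathcal C$-closed if for every homomorphism $h:X\to Y$ to a topological semigroup $Y\in\mathcal C$ the image $h[X]$ is closed in $Y$; - projectively $\mathcal C$-closed if for every congruence $\approx$ on $X$ the quotient semigroup $X/_{\approx}$ is $\mathcal C$-closed. (A congruence is an equivalence relation $\approx$ such that $x\approx y$ implies $ax\approx ay$ and $xa\approx ya$ for all $a\in X$.) For a semigroup $X$, $E(X)=\{x\in X: xx=x\}$; for $e\in E(X)$, $H_e$ is the maximal subgroup of $X$ containing $e$; $H(X)=\bigcup_{e\in E(X)}H_e$.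 A semigroup $X$ is called: - bounded if there exists $n\in\mathbb N$ (positive) such that $x^n$ is an idempotent for every $x\in X$; - chain-finite if every infinite set $I\subseteq X$ contains elements $x,y\in I$ with $xy\notin\{x,y\}$; - group-finite if every subgroup of $X$ is finite; - Clifford+finite if $X\setminus H(X)$ is finite. *)

(* Defs.v *)
From HB Require Import structures.
From mathcomp Require Import all_boot.
From mathcomp Require Import all_classical.
From mathcomp Require Import topology separation_axioms.

Set Implicit Arguments.
Unset Strict Implicit.
Unset Printing Implicit Defensive.

Local Open Scope classical_set_scope.
Local Open Scope quotient_scope.
Local Open Scope group_scope.

HB.mixin Record SemigroupTopological_isTopSemigroup T
    of Semigroup T & Topological T := {
  mulg_continuous : continuous (fun p : T * T => p.1 * p.2)
}.

#[short(type="topSemigroupType")]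
HB.structure Definition TopSemigroup :=
  {T of Semigroup T & Topological T & SemigroupTopological_isTopSemigroup T}.

(* The library's [zero_dimensional] only says that distinct points are
   separated by clopen sets, which for Hausdorff spaces is weaker than having
   a clopen base. *)
Definition has_clopen_base (T : topologicalType) :=
  exists2 B : set (set T), basis B & B `<=` clopen.

(* Classes of topological semigroups are plain predicates rather than [set]s:
   [set topSemigroupType] raises a universe inconsistency. *)
Definition T2S (Y : topSemigroupType) : Prop := hausdorff_space Y.

Definition TzS (Y : topSemigroupType) : Prop :=
  hausdorff_space Y /\ has_clopen_base Y.

Definition topological_embedding (S T : topologicalType) (h : S -> T) :=
  [/\ injective h, continuous h &
      forall U : set S, open U ->
        exists2 V : set T, open V & h @` U = V `&` range h].

Section Closedness.
Variable C : topSemigroupType -> Prop.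

Definition C_closed (X : semigroupType) :=
  forall (Y : topSemigroupType) (h : {multiplicative X -> Y}), C Y ->
    topological_embedding (h : discrete_topology X -> Y) ->
    closed (range h).

Definition injectively_C_closed (X : semigroupType) :=
  forall (Y : topSemigroupType) (h : {multiplicative X -> Y}), C Y ->
    injective h -> closed (range h).

Definition absolutely_C_closed (X : semigroupType) :=
  forall (Y : topSemigroupType) (h : {multiplicative X -> Y}), C Y ->
    closed (range h).

End Closedness.

(* Boolean relations lose no generality: every Prop-valued relation is
   reflected by a boolean one through [asbool]. *)
Definition congruence (X : semigroupType) (e : rel X) :=
  forall a x y : X, e x y -> e (a * x) (a * y) /\ e (x * a) (y * a).

Section QuotientSemigroup.
Variables (X : semigroupType) (e : equiv_rel X) (ce : congruence e).

Definition quotient_mul (u v : {eq_quot e}) : {eq_quot e} :=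
  \pi_{eq_quot e} (repr u * repr v).

Lemma pi_quotient_mul (x y : X) :
  \pi_{eq_quot e} (x * y) =
  quotient_mul (\pi_{eq_quot e} x) (\pi_{eq_quot e} y).
Proof.
rewrite /quotient_mul; apply/eqmodP.
case: piP => x' /eqmodP exx'; case: piP => y' /eqmodP eyy'.
exact: (@equiv_trans _ e _ _ _ (ce y exx').2 (ce x' eyy').1).
Qed.

Lemma quotient_mulA : associative quotient_mul.
Proof.
elim/quotW=> x; elim/quotW=> y; elim/quotW=> z.
rewrite -(pi_quotient_mul y z) -(pi_quotient_mul x y).
by rewrite -(pi_quotient_mul x) -(pi_quotient_mul (x * y)) mulgA.
Qed.

Definition quotient_semigroup of congruence e : Type := {eq_quot e}.

HB.instance Definition _ :=
  Choice.copy (quotient_semigroup ce) {eq_quot e}.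
HB.instance Definition _ :=
  isSemigroup.Build (quotient_semigroup ce) quotient_mulA.

End QuotientSemigroup.

Definition projectively_C_closed (C : topSemigroupType -> Prop)
    (X : semigroupType) :=
  forall (e : equiv_rel X) (ce : congruence e),
    C_closed C (quotient_semigroup ce).

Section SemigroupProperties.
Variable X : semigroupType.

Definition idempotents : set X := [set x | x * x = x].

(* Subgroups need not share an identity: [X] has no distinguished unit. *)
Definition is_subgroup (G : set X) :=
  (forall x y, G x -> G y -> G (x * y)) /\
  exists2 e, G e &
    forall x, G x -> [/\ e * x = x, x * e = x &
                         exists2 y, G y & x * y = e /\ y * x = e].

Definition is_maximal_subgroup (e : X) (H : set X) :=
  [/\ is_subgroup H, H e &
      forall G : set X, is_subgroup G -> H `<=` G -> G = H].

Definition clifford_part : set X :=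
  [set x | exists e H, [/\ idempotents e, is_maximal_subgroup e H & H x]].

(* For [0 < n], [iterop n *%g x x] is the product of [n] copies of [x];
   the last argument is the value at [n = 0] and is irrelevant. *)
Definition bounded_semigroup :=
  exists2 n : nat, (0 < n)%N & forall x : X, idempotents (iterop n *%g x x).

Definition chain_finite :=
  forall I : set X, infinite_set I ->
    exists x y, [/\ I x, I y & ~ [set x; y] (x * y)].

Definition group_finite := forall G : set X, is_subgroup G -> finite_set G.

Definition clifford_plus_finite := finite_set (~` clifford_part).

End SemigroupProperties.

(* Main.v *)
Require Import Defs.
From HB Require Import structures.
From mathcomp Require Import all_boot.
From mathcomp Require Import all_classical.
From mathcomp Require Import topology separation_axioms.
From mathcomp Require Import zify.

(* (2) => (3): a set of filters on [X] that decide a Boolean algebra of subsets,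
   and are closed under a limit multiplication continuous for that algebra, is a
   zero-dimensional Hausdorff semigroup in which the image of [X] is dense; if
   [X] is closed there then every filter of the family has a limit in [X].
   Each condition of (3) is obtained by exhibiting, when it fails, such a family
   with a limitless filter: translates of a free ultrafilter on an infinite
   chain or on an infinite set squaring to a point (chain-finiteness, and
   finiteness of [X \ H(X)] through Rees quotients); tails of [a x^i]
   (periodicity); unions of cosets [x_i^m K_i] exhausting a group of unbounded
   exponent; Cauchy filters for the finite-index subgroups of a countable
   elementary abelian p-group (finiteness of subgroups).
   Together these facts make [X] residually finite, so a completion can be crossed
   with the finite quotients to become injective: injective closedness then
   applies to every completion, and an antichain of idempotents carrying group
   elements of growing orders contradicts it (boundedness).

   (3) => (1): let an ultrafilter [p] on [X] map to a limit [y]. Chain-finiteness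
   gives the largest idempotent [s] with [s <= x^n] for [p]-almost all [x], and
   [h s = y^n]; then [x s] runs through the finite group [H_s], so [y] lies in
   its image. *)

Set Implicit Arguments.
Unset Strict Implicit.
Unset Printing Implicit Defensive.

Local Open Scope classical_set_scope.
Local Open Scope quotient_scope.
Local Open Scope group_scope.

(** * Ultrafilters and powers *)

(** Projective closedness speaks of discrete embeddings only, so a completion can refute it only if
    the classes of the congruence are open there, that is, if every filter of the family decides
    every class. Chains, null sets, periodicity and bounded exponent admit such families. Cauchy
    filters for finite-index subgroups and the collapse of many elements to one zero do not: their
    points are not isolated. This is where injective closedness enters, which asks nothing of the
    topology of the image, only that points be separated.

    The powers of 2 in the two constructions with a sequence [x i] have one origin. The [k]-th
    neighbourhood of the new point admits exponents of [x i] up to [2 ^ (i - k)], so the exponents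
    of two members of the next neighbourhood add up to an admissible one: this is continuity of
    multiplication there. The [x i] are chosen of order large against [2 ^ i], so that exponents do
    not wrap around. *)

Section Ultrafilters.

Lemma ultra_setC (T : Type) (p : set_system T) {Up : UltraFilter p}
    (A : set T) : ~ p A -> p (~` A).
Proof. by case: (in_ultra_setVsetC A Up). Qed.

Lemma filter_set0 (T : Type) (p : set_system T) {pF : ProperFilter p} :
  ~ p set0.
Proof. by move=> /filter_ex[]. Qed.

Lemma filter_disjoint (T : Type) (p : set_system T) {pF : ProperFilter p}
    (A B : set T) : p A -> p B -> (forall x, A x -> ~ B x) -> False.
Proof. by move=> pA pB dAB; have [x [/dAB]] := filter_ex (filterI pA pB). Qed.

Lemma filter_finite_bigcap (T : Type) (I : choiceType) (F : set_system T)
    {FF : Filter F} (D : set I) (A : I -> set T) : finite_set D ->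
  (forall i, D i -> F (A i)) -> F [set t | forall i, D i -> A i t].
Proof.
move=> /finite_seqP[s ->]; elim: s => [|i s IH] h.
  by apply: filterS filterT => t _ i.
have h1 : F (A i) by apply: h; rewrite /= inE eqxx.
have h2 := IH (fun j js => h j (mem_behead (s := i :: s) js)).
apply: filterS (filterI h1 h2) => t [ti ts] j /=.
by rewrite inE => /orP[/eqP ->//|]; exact: ts.
Qed.

Lemma ultra_finite (T : Type) (U : choiceType) (p : set_system T)
    {Up : UltraFilter p} (f : T -> U) (D : set U) : finite_set D ->
      p (f @^-1` D) ->
  exists2 c, D c & p [set t | f t = c].
Proof.
move=> Dfin pD; apply: contrapT => nex.
have /(filter_finite_bigcap (F := p) Dfin) : forall c, D c ->
  p (~` [set t | f t = c]).
  by move=> c Dc; apply: ultra_setC => pc; apply: nex; exists c.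
move=> pD'; apply: (filter_disjoint pD pD') => t /= Dt h; exact: (h _ Dt).
Qed.

Lemma ultra_mem_finite (T : choiceType) (p : set_system T) {Up : UltraFilter p}
    (D : set T) : finite_set D -> p D -> exists2 c, D c & p [set c].
Proof. exact: (@ultra_finite T T p Up id D). Qed.

Lemma free_ultrafilter (T : choiceType) (A : set T) : infinite_set A ->
  exists p : set_system T,
    [/\ UltraFilter p, p A & forall D, finite_set D -> ~ p D].
Proof.
move=> Ainf.
pose F : set_system T := [set B | finite_set (A `\` B)].
have FF : ProperFilter F.
  apply: Build_ProperFilter_ex.
    move=> B FB; apply: contrapT => B0; apply: Ainf.
    apply: sub_finite_set FB => x Ax; split => // Bx; apply: B0; by exists x.
  split.
  - by rewrite /F /= setDT; exact: finite_set0.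
  - move=> B B' FB FB'; rewrite /F /=.
    apply: (@sub_finite_set _ _ ((A `\` B) `|` (A `\` B'))).
      move=> x [Ax nBx]; case: (pselect (B x)) => Bx; [right|by left].
      by split=> // B'x; apply: nBx.
    by rewrite finite_setU.
  - move=> B B' BB' FB; apply: sub_finite_set FB => x [Ax nB'] ; split => //.
    by move/BB'.
have [p [Up Fp]] := ultraFilterLemma FF.
exists p; split => //.
  by apply: Fp; rewrite /F /= setDv; exact: finite_set0.
move=> D Dfin pD; have pDC : p (~` D).
  by apply: Fp; rewrite /F /= setDE setCK; exact: finite_setIr.
by apply: (filter_disjoint pD pDC) => x Dx; apply.
Qed.

Lemma infinite_sequence (T : Type) (A : set T) : infinite_set A ->
  exists t : nat -> T, (forall i, A (t i)) /\ injective t.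
Proof.
move=> /infiniteP/card_leP[f].
exists (fun i => val (f (SigSub (mem_set (I : [set: nat] i))))); split.
  by move=> i; exact: set_valP.
move=> i j /val_inj ij; have := @inj _ _ _ f _ _ _ _ ij.
by rewrite !in_setT => /(_ isT isT) [].
Qed.

Lemma sequence_infinite (T : Type) (A : set T) (t : nat -> T) :
  (forall i, A (t i)) -> injective t -> infinite_set A.
Proof.
move=> tA tinj Afin; apply: infinite_nat.
apply: (@sub_finite_set _ _ (t @^-1` A)) => [i _|]; first exact: tA.
by apply: finite_preimage => // i j _ _; exact: tinj.
Qed.

Lemma principal_filterE (T : Type) (a : T) (A : set T) :
  principal_filter a A = A a.
Proof. by apply: propext; rewrite principal_filterP. Qed.

End Ultrafilters.

Section Powers.
Variable X : semigroupType.
Implicit Types (x y : X) (m n : nat).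

(** Without a unit the value at exponent 0 is a default, here [x]; hence the many conditions
    [0 < n]. *)
Definition pow x n : X := iterop n *%g x x.

Lemma powS x n : (0 < n)%N -> pow x n.+1 = x * pow x n.
Proof. by case: n. Qed.

Lemma powD x m n : (0 < m)%N -> (0 < n)%N -> pow x (m + n) = pow x m * pow x n.
Proof.
move=> m0 n0; elim: m m0 => // m IH _; case: m IH => [|m] IH.
  by rewrite add1n powS.
by rewrite addSn (@powS x (m.+1 + n)%N) // IH // (@powS x m.+1) // mulgA.
Qed.

Lemma powM x m n : (0 < m)%N -> (0 < n)%N -> pow x (m * n) = pow (pow x m) n.
Proof.
move=> m0 n0; elim: n n0 => // n IH _; case: n IH => [|n] IH;
  first by rewrite muln1.
by rewrite mulnS powD ?muln_gt0 ?m0 // IH // -powS.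
Qed.

Lemma pow_idem x n : x * x = x -> pow x n = x.
Proof.
move=> xx; case: n => // n; elim: n => // n IH; by rewrite powS // IH.
Qed.

Lemma pow_idem_dvd x m n : (0 < n)%N -> (m %| n)%N ->
  pow x m * pow x m = pow x m -> pow x n = pow x m.
Proof.
move=> n0 /dvdnP[k nE] xm; rewrite nE in n0 *; move: n0.
by rewrite muln_gt0 => /andP[k0 m0]; rewrite mulnC powM // pow_idem.
Qed.

Hypothesis hcomm : commutative (@mul X).

Lemma mulgCA x y z : x * (y * z) = y * (x * z).
Proof. by rewrite mulgA (hcomm x y) -mulgA. Qed.

Lemma mulgAC x y z : x * y * z = x * z * y.
Proof. by rewrite -!mulgA (hcomm y z). Qed.

Lemma mulgACA x y z t : (x * y) * (z * t) = (x * z) * (y * t).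
Proof. by rewrite -!mulgA (mulgCA y). Qed.

Lemma powMl x y n : pow (x * y) n = pow x n * pow y n.
Proof.
case: n => // n; elim: n => // n IH.
by rewrite powS // IH mulgACA -!powS.
Qed.

End Powers.

(** * The completion of a semigroup by a set of filters *)

(** Because every filter decides [B], the last field pins down the trace of [H] on [B];
    associativity then carries over from products of elements of [X]. *)
Record completion (X : semigroupType) (B : set (set X))
    (P : set (set_system X)) : Prop := Completion {
  completion_setT : B setT;
  completion_setC : forall A, B A -> B (~` A);
  completion_setI : forall A A', B A -> B A' -> B (A `&` A');
  completion_proper : forall F, P F -> ProperFilter F;
  completion_dec : forall F A, P F -> B A -> F A \/ F (~` A);
  completion_principal : forall a, P (principal_filter a);
  completion_mul : forall F G, P F -> P G -> exists2 H, P H &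
    forall A, B A -> H A -> exists U V,
      [/\ B U, B V, F U, G V & forall u v, U u -> V v -> A (u * v)]
}.

Section CompletionSpace.
Variables (X : semigroupType) (B : set (set X)) (P : set (set_system X)).
Hypothesis cBP : completion B P.

(** Points are traces on [B] rather than filters: filters with the same trace could not be separated
    by cells. The proof of [completion] is a parameter so that structures can be attached to the
    type. *)
Definition completion_point of completion B P : Type :=
  {y : set (set X) | exists2 F, P F & y = F `&` B}.

Local Notation Y := (completion_point cBP).

Definition trace (y : Y) : set (set X) := sval y.

HB.instance Definition _ := gen_eqMixin Y.
HB.instance Definition _ := gen_choiceMixin Y.

Lemma traceP (y : Y) : exists2 F, P F & trace y = F `&` B.
Proof. exact: svalP y. Qed.

Lemma trace_inj : injective trace.
Proof. move=> [y py] [z pz] /= yz; rewrite /trace /= in yz;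
  subst z. by congr exist; exact: Prop_irrelevance. Qed.

Lemma trace_dec (y : Y) A : B A -> trace y A \/ trace y (~` A).
Proof.
move=> BA; have [F PF ->] := traceP y.
have [FA|FA] := completion_dec cBP PF BA; first by left.
by right; split => //; exact: (completion_setC cBP).
Qed.

Lemma trace_sub (y : Y) A : trace y A -> B A.
Proof. by have [F PF ->] := traceP y; case. Qed.

Lemma trace_ex (y : Y) A : trace y A -> A !=set0.
Proof.
have [F PF ->] := traceP y; case=> FA _; have FF := completion_proper cBP PF.
exact: filter_ex FA.
Qed.

Lemma traceI (y : Y) A A' : trace y A -> trace y A' -> trace y (A `&` A').
Proof.
have [F PF ->] := traceP y; have FF := completion_proper cBP PF.
move=> [FA BA] [FA' BA']; split; [exact: filterI|exact: (completion_setI cBP)].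
Qed.

Lemma trace_setT (y : Y) : trace y setT.
Proof.
have [F PF ->] := traceP y; have FF := completion_proper cBP PF.
by split; [exact: filterT|exact: (completion_setT cBP)].
Qed.

Lemma traceC (y : Y) A : trace y A -> trace y (~` A) -> False.
Proof. by move=> yA yA'; have [x []] := trace_ex (traceI yA yA'). Qed.

Lemma trace_ext (y z : Y) : trace y `<=` trace z -> y = z.
Proof.
move=> yz; apply: trace_inj; rewrite eqEsubset; split => // A zA.
have [//|/yz zA'] := trace_dec y (trace_sub zA).
by have := traceC zA zA'.
Qed.

Definition cell (A : set X) : set Y := [set y | trace y A].

Lemma cell_cover : \bigcup_(A in B) cell A = setT.
Proof.
rewrite -subTset => y _; exists setT; [exact: (completion_setT cBP)|exact:
  trace_setT].
Qed.

Lemma cell_join A A' y : B A -> B A' -> cell A y -> cell A' y ->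
  exists C, [/\ B C, cell C y & cell C `<=` cell A `&` cell A'].
Proof.
move=> BA BA' yA yA'; exists (A `&` A'); split;
  first exact: (completion_setI cBP).
  exact: traceI.
move=> z zAA; split; rewrite /cell /=.
  have [//|zA] := trace_dec z BA.
  by have [x [[]]] := trace_ex (traceI zAA zA).
have [//|zA] := trace_dec z BA'.
by have [x [[]]] := trace_ex (traceI zAA zA).
Qed.

HB.instance Definition _ := isBaseTopological.Build Y cell_cover cell_join.

Lemma open_cell A : B A -> open (cell A).
Proof.
move=> BA; exists [set A]; first by move=> _ ->.
by rewrite bigcup_set1.
Qed.

Lemma setC_cell A : B A -> ~` cell A = cell (~` A).
Proof.
move=> BA; rewrite eqEsubset; split => y.
  by have [|] := trace_dec y BA.
by move=> yA' yA; exact: traceC yA yA'.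
Qed.

Lemma clopen_cell A : B A -> clopen (cell A).
Proof.
move=> BA; split; first exact: open_cell.
rewrite -openC setC_cell //; apply: open_cell; exact: (completion_setC cBP).
Qed.

Lemma nbhs_cell (y : Y) (O : set Y) : nbhs y O ->
  exists A, trace y A /\ cell A `<=` O.
Proof.
rewrite nbhsE => -[O' [[D DB <-] [A DA yA]] O'O].
exists A; split => // z zA; apply: O'O; by exists A.
Qed.

Lemma cell_nbhs (y : Y) A : trace y A -> nbhs y (cell A).
Proof.
by move=> yA; apply: open_nbhs_nbhs; split => //; apply: open_cell;
  exact: trace_sub yA.
Qed.

Lemma completion_hausdorff : hausdorff_space Y.
Proof.
move=> y z clyz; apply: trace_ext => A yA.
have [//|zA] := trace_dec z (trace_sub yA).
have [x []] := clyz _ _ (cell_nbhs yA) (cell_nbhs zA).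
by move=> xA xA'; have := traceC xA xA'.
Qed.

Lemma completion_clopen_base : has_clopen_base Y.
Proof.
exists (cell @` B); last by move=> _ [A BA <-]; exact: clopen_cell.
split; first by move=> _ [A BA <-]; exact: open_cell.
move=> y O /nbhs_cell[A [yA AO]]; exists (cell A) => //.
split => //; exists A => //; exact: trace_sub yA.
Qed.

Lemma principal_point_subproof a :
  exists2 F, P F & principal_filter a `&` B = F `&` B.
Proof. by exists (principal_filter a) => //;
  exact: (completion_principal cBP). Qed.

Definition principal_point a : Y := exist _ _ (principal_point_subproof a).

Lemma trace_principal a A : trace (principal_point a) A <-> A a /\ B A.
Proof.
by split => -[pA BA]; split => //; move: pA; rewrite principal_filterP.
Qed.

Lemma completion_mul_subproof (y z : Y) : exists w : Y, forall A, trace w A ->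
  exists U V, [/\ trace y U, trace z V & forall u v, U u -> V v -> A (u * v)].
Proof.
have [F PF yE] := traceP y; have [G PG zE] := traceP z.
have [H PH h] := completion_mul cBP PF PG.
exists (exist _ (H `&` B) (ex_intro2 _ _ H PH erefl)) => A [HA BA].
have [U [V [BU BV FU GV UV]]] := h A BA HA; exists U, V.
by rewrite yE zE; split.
Qed.

Definition completion_op (y z : Y) : Y := sval (cid (completion_mul_subproof y
  z)).

Lemma completion_opP (y z : Y) A : trace (completion_op y z) A ->
  exists U V, [/\ trace y U, trace z V & forall u v, U u -> V v -> A (u * v)].
Proof. exact: svalP (cid (completion_mul_subproof y z)) A. Qed.

(** If the trace of the product chose the complement of [A], the sets from [completion_opP] would
    meet [U] and [V], and a product of common elements would lie both in [A] and outside it. *)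
Lemma completion_op_cell (y z : Y) U V A : B A -> trace y U -> trace z V ->
  (forall u v, U u -> V v -> A (u * v)) -> trace (completion_op y z) A.
Proof.
move=> BA yU zV UV; have [//|] := trace_dec (completion_op y z) BA.
move=> /completion_opP[U' [V' [yU' zV' UV']]].
have [u [uU uU']] := trace_ex (traceI yU yU').
have [v [vV vV']] := trace_ex (traceI zV zV').
by have := UV' _ _ uU' vV'; case; exact: UV.
Qed.

Lemma completion_opA : associative completion_op.
Proof.
move=> x y z; apply: trace_ext => A wA; have BA := trace_sub wA.
have [//|] := trace_dec (completion_op (completion_op x y) z) BA.
move=> /completion_opP[C [V [/completion_opP[W [W' [xW yW' WW']]] zV CV]]].
move: wA => /completion_opP[U [D [xU /completion_opP[U' [V' [yU' zV' UV']]]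
  UD]]].
have [u [uU uW]] := trace_ex (traceI xU xW).
have [u' [u'U u'W]] := trace_ex (traceI yU' yW').
have [v [vV vV']] := trace_ex (traceI zV zV').
have := CV _ _ (WW' _ _ uW u'W) vV; case; rewrite -mulgA.
by apply: UD => //; exact: UV'.
Qed.

HB.instance Definition _ := isSemigroup.Build Y completion_opA.

Lemma completion_op_continuous : continuous (fun p : Y * Y => p.1 * p.2).
Proof.
move=> [y z] O /nbhs_cell[A [yzA AO]] /=.
have [U [V [yU zV UV]]] := completion_opP yzA.
exists (cell U, cell V); first by split; exact: cell_nbhs.
move=> [y' z'] [/= y'U z'V]; apply: AO => /=.
exact: completion_op_cell (trace_sub yzA) y'U z'V UV.
Qed.

HB.instance Definition _ :=
  SemigroupTopological_isTopSemigroup.Build Y completion_op_continuous.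

Lemma principal_pointM : {morph principal_point : a b / a * b}.
Proof.
move=> a b; symmetry; apply: trace_ext => A abA; have BA := trace_sub abA.
move: abA => /completion_opP[U [V [/trace_principal[Ua _]
  /trace_principal[Vb _]]]].
by move=> /(_ _ _ Ua Vb) Aab; apply/trace_principal.
Qed.

HB.instance Definition _ := isMultiplicative.Build X Y principal_point
  principal_pointM.

End CompletionSpace.

Section Use.
Variables (X : semigroupType) (B : set (set X)) (P : set (set_system X)).
Hypothesis cBP : completion B P.

Lemma completion_semigroup : exists (Y : topSemigroupType)
    (h : {multiplicative X -> Y}),
  [/\ TzS Y,
      forall a b, h a = h b <-> (forall A, B A -> A a <-> A b),
      forall A, B A -> exists2 O, open O & forall a, O (h a) <-> A a &
      closed (range h) -> forall F, P F ->
        exists a, forall A, B A -> F A <-> A a].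
Proof.
pose Y : topSemigroupType := completion_point cBP.
exists Y, (@principal_point X B P cBP : {multiplicative X -> Y}).
split.
- by split; [exact: completion_hausdorff|exact: completion_clopen_base].
- move=> a b; split => [ab A BA|ab].
    have e c : A c <-> trace (principal_point cBP c) A.
      by rewrite trace_principal; split => [|[]].
    by rewrite !e ab.
  by apply: trace_ext => A /trace_principal[Aa BA]; apply/trace_principal;
    split => //; apply: (ab A BA).1.
- move=> A BA; exists (@cell X B P cBP A : set Y); first exact: open_cell.
  move=> a; have [t1 t2] := trace_principal cBP a A.
  by split => [/t1[]|Aa] //; exact: t2.
- move=> cl F PF.
  pose y : Y := exist _ (F `&` B) (ex_intro2 _ _ F PF erefl).
  have yE : trace (y : completion_point cBP) = F `&` B by [].
  have : closure (range (principal_point cBP)) y.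
    move=> O /nbhs_cell[A [yA AO]]; have [a Aa] := trace_ex yA.
    exists (principal_point cBP a); split; first by exists a.
    apply: AO; apply: (trace_principal cBP a A).2; split => //;
      exact: trace_sub yA.
  move=> /cl[a _ ay]; exists a => A BA.
  have [h1 h2] : trace (y : completion_point cBP) A <-> A a /\ B A by rewrite
    -ay; exact: trace_principal.
  rewrite yE in h1 h2; split => [FA|Aa]; first by case: h1.
  by case: h2.
Qed.

End Use.

(** * Closedness and completions *)

Section ClosedRange.
Variable C : topSemigroupType -> Prop.
Hypothesis hTz : forall Y : topSemigroupType, TzS Y -> C Y.

Lemma injective_completion (X : semigroupType) (B : set (set X))
    (P : set (set_system X)) : injectively_C_closed C X -> completion B P ->
    (forall a b, (forall A, B A -> A a <-> A b) -> a = b) ->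
  forall F, P F -> exists a, forall A, B A -> F A <-> A a.
Proof.
move=> inj cBP sepB; have [Y [h [TY hE _]]] := completion_semigroup cBP.
by apply; apply: inj; [exact: hTz|move=> a b /hE/sepB].
Qed.

(** The open sets in the hypothesis isolate each point of the image, so the map induced on the
    quotient by the kernel of [h] embeds a discrete space, and closedness of that quotient
    applies. *)
Lemma projectively_closed_range (X : semigroupType) (Y : topSemigroupType)
    (h : {multiplicative X -> Y}) : projectively_C_closed C X -> C Y ->
    (forall a, exists2 O, open O & O (h a) /\ forall b, O (h b) -> h b = h a) ->
  closed (range h).
Proof.
move=> proj CY hiso.
pose e : rel X := fun a b => h a == h b.
have e_trans : transitive e by move=> b a c /eqP ab /eqP bc; apply/eqP;
  rewrite ab.
have e_sym : symmetric e by move=> a b; rewrite /e eq_sym.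
pose E := EquivRel e (fun a => eqxx (h a)) e_sym e_trans.
have cE : congruence E.
  by move=> a x y /eqP xy; split; apply/eqP; rewrite !gmulfM xy.
have hpi a : h (repr (\pi_{eq_quot E} a)%qT) = h a.
  by case: piP => b /eqmodP/eqP.
pose k : quotient_semigroup cE -> Y := fun q => h (repr (q : {eq_quot E})).
have kM : {morph k : p q / p * q}.
  move=> p q; rewrite /k -gmulfM; exact: hpi.
pose km := isMultiplicative.Build (quotient_semigroup cE) Y k kM.
pose K : {multiplicative quotient_semigroup cE -> Y} := HB.pack k km.
have rE : range h = range K.
  rewrite eqEsubset; split => _ [a _ <-].
    by exists (\pi_{eq_quot E} a)%qT => //; exact: hpi.
  by exists (repr (a : {eq_quot E})).
rewrite rE; apply: (proj E cE Y K CY); split.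
- move=> p q pq.
  have /eqmodP : E (repr (p : {eq_quot E})) (repr (q : {eq_quot E})) by
    apply/eqP.
  by rewrite !reprK.
- move=> p O /nbhs_singleton Op.
  apply: (@open_nbhs_nbhs (discrete_topology (quotient_semigroup cE))).
  by split => //; exact: (@discrete_open (discrete_topology (quotient_semigroup
    cE))).
- move=> U _.
  exists (\bigcup_(O in [set O | open O /\ exists2 q,
    U q & O `&` range K = [set K q]]) O).
    by apply: bigcup_open => O [].
  rewrite eqEsubset; split.
    move=> _ [q Uq <-]; split; last by exists q.
    have [O oO [Oq Ob]] := hiso (repr (q : {eq_quot E})); exists O => //;
      split => //.
    exists q => //; rewrite eqEsubset; split; last by move=> _ ->; split => //;
      exists q.
    by move=> _ [] /[swap] -[b _ <-] /= /Ob.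
  move=> y [[O [oO [q Uq OE]] Oy] ry]; have : (O `&` range K) y by [].
  by rewrite OE => ->; exists q.
Qed.

Record semigroup_congruence (X : semigroupType) (R : X -> X -> Prop) : Prop :=
  SemigroupCongruence {
    congruence_refl : forall a, R a a;
    congruence_sym : forall a b, R a b -> R b a;
    congruence_trans : forall a b c, R a b -> R b c -> R a c;
    congruence_mul : forall a a' b b', R a a' -> R b b' -> R (a * b) (a' * b')
  }.

Lemma kernel_congruence (X : semigroupType) (T : Type) (f : X -> T) :
  (forall a a' b b', f a = f a' -> f b = f b' -> f (a * b) = f (a' * b')) ->
  semigroup_congruence (fun a b => f a = f b).
Proof. by move=> fM; split => // a b c ->. Qed.

Section ProjectiveCompletion.
Variables (X : semigroupType) (R : X -> X -> Prop) (Q : set (set_system X)).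
Hypothesis hcomm : commutative (@mul X).
Hypothesis cR : semigroup_congruence R.
Hypothesis Qproper : forall F, Q F -> ProperFilter F.

Definition saturated (A : set X) := forall a b, R a b -> A a -> A b.

(** The largest Boolean algebra of unions of [R]-classes on which [completion_dec] can hold for
    [Q]. *)
Definition decidable_sets : set (set X) :=
  [set A | saturated A /\ forall F, Q F -> F A \/ F (~` A)].

Definition extended_filters : set (set_system X) :=
  [set F | Q F \/ exists a, F = principal_filter a].

Lemma saturatedC A : saturated A -> saturated (~` A).
Proof. move=> sA a b ab nAa Ab; apply: nAa;
  exact: sA (congruence_sym cR ab) Ab. Qed.

Lemma decidable_setT : decidable_sets setT.
Proof. by split=> // F QF; left; have FF := Qproper QF; exact: filterT. Qed.

Lemma decidable_setC A : decidable_sets A -> decidable_sets (~` A).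
Proof.
move=> [sA dA]; split=> [|F QF]; first exact: saturatedC.
by rewrite setCK; have [] := dA F QF; [right|left].
Qed.

Lemma decidable_setI A A' : decidable_sets A -> decidable_sets A' ->
  decidable_sets (A `&` A').
Proof.
move=> [sA dA] [sA' dA']; split=> [a b ab [Aa A'a]|F QF].
  by split; [exact: sA Aa|exact: sA' A'a].
have FF := Qproper QF; have [FA|FA] := dA F QF; last first.
  by right; apply: filterS FA => x /= nA [].
have [FA'|FA'] := dA' F QF; first by left; exact: filterI.
by right; apply: filterS FA' => x /= nA [].
Qed.

(** Makes each class a clopen cell, hence each point of the image isolated, as
    [projectively_closed_range] requires. *)
Hypothesis classQ : forall F a, Q F -> F (R a) \/ F (~` (R a)).

Hypothesis mulQQ : forall F G, Q F -> Q G -> exists2 H, extended_filters H &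
  forall A, decidable_sets A -> H A -> exists U V,
    [/\ decidable_sets U, decidable_sets V, F U, G V &
        forall u v, U u -> V v -> A (u * v)].

Hypothesis mulXQ : forall a G, Q G -> exists2 H, extended_filters H &
  forall A, decidable_sets A -> H A -> exists V,
    [/\ decidable_sets V, G V & forall v, V v -> A (a * v)].

Lemma decidable_class a : decidable_sets (R a).
Proof.
split=> [b c bc ab|F QF]; first exact: (congruence_trans cR) bc.
exact: classQ.
Qed.

Lemma projective_completion_data : completion decidable_sets extended_filters.
Proof.
split; [exact: decidable_setT|exact: decidable_setC|exact: decidable_setI| | |
  |].
- by move=> F [/Qproper//|[a ->]]; exact: principal_filter_proper.
- move=> F A [QF [_ /(_ F QF)]//|[a ->] _].
  by rewrite !principal_filterE; exact: EM.
- by move=> a; right; exists a.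
- move=> F G [QF|[a ->]] [QG|[b ->]]; first exact: mulQQ.
  + have [H EH hH] := mulXQ b QF; exists H => // A dA HA.
    have [V [dV FV VA]] := hH A dA HA; exists V, (R b).
    rewrite principal_filterE; split => //; first exact: decidable_class.
      exact: (congruence_refl cR).
    move=> v c Vv bc; rewrite hcomm; apply: dA.1 (VA v Vv).
    exact: (congruence_mul cR bc (congruence_refl cR v)).
  + have [H EH hH] := mulXQ a QG; exists H => // A dA HA.
    have [V [dV GV VA]] := hH A dA HA; exists (R a), V.
    rewrite principal_filterE; split => //; first exact: decidable_class.
      exact: (congruence_refl cR).
    move=> c v ac Vv; apply: dA.1 (VA v Vv).
    exact: (congruence_mul cR ac (congruence_refl cR v)).
  + exists (principal_filter (a * b)); first by right; exists (a * b).
    move=> A dA; rewrite principal_filterE => Aab; exists (R a), (R b).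
    rewrite !principal_filterE; split; try exact: decidable_class;
      try exact: (congruence_refl cR).
    by move=> u v au bv; apply: dA.1 Aab; exact: (congruence_mul cR).
Qed.

Lemma projective_completion : projectively_C_closed C X ->
  forall F, Q F -> exists a, F (R a).
Proof.
move=> proj F QF.
have [Y [h [TY hE hO]]] := completion_semigroup projective_completion_data.
case/(_ _)/(_ F)=> [||a aE]; last 2 first.
- by left.
- exists a; apply/(aE _ (decidable_class a)); exact: (congruence_refl cR).
apply: projectively_closed_range proj (hTz TY) _ => a.
have [O oO OE] := hO _ (decidable_class a); exists O => //; split.
  by apply/OE; exact: (congruence_refl cR).
move=> b /OE ab; apply/hE => A [sA _]; split; apply: sA => //.
exact: (congruence_sym cR).
Qed.

End ProjectiveCompletion.

End ClosedRange.

(** * Crossing a completion with a directed family of congruences *)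

Section CauchyCompletion.
Variables (X : semigroupType) (B : set (set X)) (P : set (set_system X)).
Variable N : set (X -> X -> Prop).
Hypothesis cBP : completion B P.
Hypothesis cN : forall R, N R -> semigroup_congruence R.
Hypothesis N0 : N !=set0.
Hypothesis Ndir : forall R R', N R -> N R' -> exists2 S, N S &
  forall a b, S a b -> R a b /\ R' a b.

(** Traces of clopen sets of the completion times the discrete quotient by [R]: on each [R]-class,
    [A] agrees with a member of [B] that may vary with the class. *)
Definition cauchy_sets : set (set X) := [set A | exists R O,
  [/\ N R, forall a, B (O a), forall a b, R a b ->
    O a = O b & A = [set a | O a a]]].

(** Points of the closure of the diagonal copy of [X] in the product: a class for every [R] in [N],
    compatible with a point of the completion. *)
Definition cauchy_filters : set (set_system X) := [set F |
  [/\ ProperFilter F, forall R, N R -> exists a, F (R a) &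
      exists2 G, P G & forall A, B A -> G A -> F A]].

Definition filter_mul (F G : set_system X) : set_system X :=
  [set A | exists U V, [/\ F U, G V & forall u v, U u -> V v -> A (u * v)]].

Lemma filter_mul_proper F G : ProperFilter F -> ProperFilter G ->
  ProperFilter (filter_mul F G).
Proof.
move=> FF GF; apply: Build_ProperFilter_ex.
  move=> A [U [V [FU GV UV]]].
  have [u Uu] := filter_ex FU; have [v Vv] := filter_ex GV.
  by exists (u * v); exact: UV.
split.
- by exists setT, setT; split => //; exact: filterT.
- move=> A A' [U [V [FU GV UV]]] [U' [V' [FU' GV' UV']]].
  exists (U `&` U'), (V `&` V'); split; [exact: filterI|exact: filterI|].
  by move=> u v [Uu Uu'] [Vv Vv']; split; [exact: UV|exact: UV'].
- move=> A A' AA' [U [V [FU GV UV]]]; exists U, V; split => // u v Uu Vv.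
  by apply: AA'; exact: UV.
Qed.

Lemma cauchy_class R a A : N R -> B A -> cauchy_sets (R a `&` A).
Proof.
move=> NR BA; have cR := cN NR; exists R, (fun b => if `[< R a b >]
  then A else set0).
split => //.
- move=> b; case: ifP => // _.
  by rewrite -setCT; apply: (completion_setC cBP); exact: (completion_setT cBP).
- move=> b c bc; suff -> : `[< R a b >] = `[< R a c >] by [].
  apply: asbool_equiv_eq; split => h; first exact: (congruence_trans cR) bc.
  by apply: (congruence_trans cR) h _; exact: (congruence_sym cR).
- rewrite eqEsubset; split => b /=; first by move=> [/asboolP ->].
  by case: ifP => // /asboolP.
Qed.

Lemma cauchy_completion : completion cauchy_sets cauchy_filters.
Proof.
have BT := completion_setT cBP.
split.
- have [R NR] := N0; exists R, (fun=> setT); split => //.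
- move=> A [R [O [NR BO RO ->]]]; exists R, (fun a => ~` O a); split => //.
    by move=> a; exact: (completion_setC cBP).
  by move=> a b ab; rewrite (RO a b).
- move=> A A' [R [O [NR BO RO ->]]] [R' [O' [NR' BO' RO' ->]]].
  have [S NS SR] := Ndir NR NR'; exists S, (fun a => O a `&` O' a); split => //.
    by move=> a; exact: (completion_setI cBP).
  by move=> a b /SR[ab ab']; rewrite (RO a b) ?(RO' a b).
- by move=> F [].
- move=> F A [FF cauF [G PG GF]] [R [O [NR BO RO ->]]].
  have [a Fa] := cauF R NR; have [GO|GO] := completion_dec cBP PG (BO a).
    left; apply: filterS (filterI Fa (GF _ (BO a) GO)) => b [ab /=].
    by rewrite (RO a b).
  right; have BOC := completion_setC cBP (BO a).
  apply: filterS (filterI Fa (GF _ BOC GO)) => b [ab /=].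
  by rewrite (RO a b).
- move=> a; split; first exact: principal_filter_proper.
    move=> R NR; exists a; rewrite principal_filterE;
      exact: (congruence_refl (cN NR)).
  by exists (principal_filter a) => //; exact: (completion_principal cBP).
- move=> F' G' [FF cauF [F PF FF']] [GG cauG [G PG GG']].
  have HH := filter_mul_proper FF GG.
  have cls R a b : N R -> F' (R a) -> G' (R b) -> filter_mul F' G' (R (a * b)).
    move=> NR Fa Gb; exists (R a), (R b); split => // u v.
    exact: (congruence_mul (cN NR)).
  have [H PH hH] := completion_mul cBP PF PG.
  have HH' A : B A -> H A -> filter_mul F' G' A.
    move=> BA /(hH _ BA)[U [V [BU BV FU GV UV]]]; exists U, V; split => //.
      exact: FF'.
    exact: GG'.
  exists (filter_mul F' G').
    split => //; last by exists H.
    move=> R NR; have [a Fa] := cauF R NR; have [b Gb] := cauG R NR.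
    by exists (a * b); exact: cls.
  move=> A [R [O [NR BO RO ->]]] HA.
  have [a Fa] := cauF R NR; have [b Gb] := cauG R NR.
  have Hab := cls _ _ _ NR Fa Gb.
  (* If [H] chose the complement, [HH'] would put it in the product filter together with [A] and the
     class of [a * b], on which [A] coincides with [O (a * b)]. *)
  have HO : H (O (a * b)).
    have [//|HC] := completion_dec cBP PH (BO (a * b)).
    have := HH' _ (completion_setC cBP (BO (a * b))) HC => HC'.
    have [c [[Rc Oc] nOc]] := filter_ex (filterI (filterI Hab HA) HC').
    by case: nOc; rewrite (RO _ _ Rc).
  have [U [V [BU BV FU GV UV]]] := hH _ (BO (a * b)) HO.
  exists (R a `&` U), (R b `&` V); split.
  + exact: cauchy_class.
  + exact: cauchy_class.
  + by apply: filterI => //; exact: FF'.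
  + by apply: filterI => //; exact: GG'.
  + move=> u v [au Uu] [bv Vv] /=.
    by rewrite -(RO _ _ (congruence_mul (cN NR) au bv)); exact: UV.
Qed.

(** Separation of points is demanded of [N] alone, so [B] may identify points or even be trivial;
    both uses below exploit this. *)
Lemma cauchy_point (C : topSemigroupType -> Prop) :
  (forall Y : topSemigroupType, TzS Y -> C Y) -> injectively_C_closed C X ->
  (forall a b, a <> b -> exists2 R, N R & ~ R a b) ->
  forall F, cauchy_filters F -> exists a, (forall R, N R -> F (R a)) /\
    forall A, B A -> F A -> A a.
Proof.
move=> hTz inj sep F cF.
have BT := completion_setT cBP.
have cset R a : N R -> cauchy_sets (R a).
  by move=> NR; rewrite -[R a]setIT; exact: cauchy_class.
have Bset A : B A -> cauchy_sets A.
  by move=> BA; have [R NR] := N0; exists R, (fun=> A).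
have [|a aE] := injective_completion hTz inj cauchy_completion _ cF.
  move=> a b ab; apply: contrapT => /sep[R NR]; apply.
  have [h _] := ab (R a) (cset R a NR); apply: h;
    exact: (congruence_refl (cN NR)).
exists a; split => [R NR|A BA]; last by have [h _] := aE A (Bset A BA).
have [_ h] := aE (R a) (cset R a NR); apply: h;
  exact: (congruence_refl (cN NR)).
Qed.

End CauchyCompletion.

(** * Chain-finiteness, null sets and periodicity *)

Section UltrafilterTranslates.
Variables (C : topSemigroupType -> Prop) (X : semigroupType).
Hypothesis hTz : forall Y : topSemigroupType, TzS Y -> C Y.
Hypothesis hcomm : commutative (@mul X).
Hypothesis proj : projectively_C_closed C X.

(** [option X] is [X] with a unit [None] adjoined, so that an ultrafilter counts among its own
    translates. *)
Definition act (o : option X) (x : X) : X := if o is Some a then a * x else x.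

Definition act_mul (o o' : option X) : option X :=
  if o is Some a then Some (act o' a) else o'.

Lemma act_mulE o o' x y : act o x * act o' y = act (act_mul o o') (x * y).
Proof.
case: o o' => [a|] [b|] //=.
- by rewrite (hcomm b a) mulgACA.
- by rewrite mulgA.
- exact: mulgCA.
Qed.

Lemma act_mulA o o' x : act o (act o' x) = act (act_mul o o') x.
Proof. by case: o o' => [a|] [b|] //=; rewrite (hcomm b a) mulgA. Qed.

Definition translate (p : set_system X) (o : option X) : set_system X :=
  [set A | p (act o @^-1` A)].

(** If [p] squares to [G], the product of the translates by [a] and [b] tends to the translate of
    [G] by [a * b], again a translate of [p] or a point. Translates are ultrafilters, so they decide
    all sets and only saturation restricts the algebra. *)
Lemma ultrafilter_square (R : X -> X -> Prop) (p G : set_system X) :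
    semigroup_congruence R -> UltraFilter p ->
    (exists o, G = translate p o) \/ (exists a, G = principal_filter a) ->
    (forall A, saturated R A -> G A -> exists U V,
      [/\ p U, p V & forall u v, U u -> V v -> A (u * v)]) ->
  exists a, p (R a).
Proof.
move=> cR Up GE pG.
pose Q : set (set_system X) := [set F | exists o, F = translate p o].
have Qproper F : Q F -> ProperFilter F.
  move=> [o ->]; apply: Build_ProperFilter_ex.
    by move=> A pA; have [x xA] := filter_ex (pA : p (act o @^-1` A));
      exists (act o x).
have Qdec F A : Q F -> F A \/ F (~` A).
  by move=> [o ->]; exact: (in_ultra_setVsetC (act o @^-1` A)).
have dec A : saturated R A -> decidable_sets R Q A.
  by move=> sA; split => // F QF; exact: Qdec.
pose sat (U : set X) : set X := [set b | exists2 a, U a & R a b].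
have dsat U : decidable_sets R Q (sat U).
  apply: dec => a b ab [c Uc ca]; exists c => //;
    exact: (congruence_trans cR) ca ab.
have Qsat o U : p U -> translate p o (sat (act o @` U)).
  move=> pU; rewrite /translate /=; apply: filterS pU => u Uu;
    exists (act o u); first by exists u.
  exact: (congruence_refl cR).
have extE o : exists2 H, extended_filters Q H & forall A,
  H A <-> G (act o @^-1` A).
  case: GE => [[o' ->]|[a ->]].
    exists (translate p (act_mul o o')); first by left; exists (act_mul o o').
    move=> A; rewrite /translate /=.
    suff -> : act (act_mul o o') @^-1` A = act o' @^-1` (act o @^-1` A) by [].
    by rewrite eqEsubset; split => x /=; rewrite act_mulA.
  exists (principal_filter (act o a)); first by right; exists (act o a).
  by move=> A; rewrite !principal_filterE.
have ractl o a b : R a b -> R (act o a) (act o b).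
  case: o => [c|] //= ab; exact: (congruence_mul cR (congruence_refl cR c) ab).
have [|||a pa] := @projective_completion C hTz X R Q hcomm cR Qproper _ _ _ proj
  (translate p None) (ex_intro _ None erefl); last by exists a.
- by move=> F a; exact: Qdec.
- move=> _ _ [o ->] [o' ->]; have [H EH HE] := extE (act_mul o o');
  exists H => //.
  move=> A [sA _] /HE GA.
  have [|U [V [pU pV UV]]] := pG _ _ GA.
    by move=> a b ab; apply: sA; exact: ractl.
  exists (sat (act o @` U)), (sat (act o' @` V)); split => //; try exact: Qsat.
  move=> u v [_ [u' Uu' <-] uu] [_ [v' Vv' <-] vv].
  apply: sA (congruence_mul cR uu vv) _; rewrite act_mulE; exact: UV.
- move=> a _ [o ->]; exists (translate p (act_mul (Some a) o)).
    by left; exists (act_mul (Some a) o).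
  move=> A [sA _] pA; exists (act (Some a) @^-1` A); split => //.
    by apply: dec => b c bc; exact: sA (ractl (Some a) _ _ bc).
  rewrite /translate /= in pA *; apply: filterS pA => x /=.
  by rewrite -[a * act o x]/(act (Some a) (act o x)) act_mulA.
Qed.

(** In a set [I] violating the condition every product is one of its factors, so an ultrafilter on
    [I] is its own limit square. *)
Lemma projectively_closed_chain_finite : chain_finite X.
Proof.
move=> I Iinf; apply: contrapT => nI.
have chain x y : I x -> I y -> [set x; y] (x * y).
  by move=> Ix Iy; apply: contrapT => h; apply: nI; exists x, y.
have [p [Up pI pfree]] := free_ultrafilter Iinf.
have cE : semigroup_congruence (@eq X) by apply: (@kernel_congruence X X id) =>
  ? ? ? ? -> ->.
have [||a pa] := @ultrafilter_square _ p p cE Up.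
- by left; exists None.
- move=> A _ pA; exists (A `&` I), (A `&` I); split; try exact: filterI.
  by move=> u v [Au Iu] [Av Iv]; case: (chain u v Iu Iv) => ->.
by apply: (pfree _ _ pa); apply: (sub_finite_set _ (finite_set1 a)) => b <-.
Qed.

Definition semigroup_ideal (J : set X) := forall a b, J b -> J (a * b).

(* The Rees quotient by [J] would contain the infinite set [A] with [A * A]
   a single point; any free ultrafilter on [A] then squares to that point. *)
Lemma finite_square_in_ideal (J A : set X) : semigroup_ideal J -> J !=set0 ->
  (forall a, A a -> ~ J a) -> (forall a b, A a -> A b -> J (a * b)) ->
  finite_set A.
Proof.
move=> iJ [j Jj] AJ AA; apply: contrapT => Ainf.
have iJ' a b : J a -> J (a * b) by rewrite hcomm; exact: iJ.
have [p [Up pA pfree]] := free_ultrafilter Ainf.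
pose R a b := a = b \/ J a /\ J b.
have cR : semigroup_congruence R.
  split.
  - by left.
  - by move=> a b [->|[Ja Jb]]; [left|right].
  - by move=> a b c [->//|[Ja Jb]] [<-|[_ Jc]]; right.
  - move=> a a' b b' [->|[Ja Ja']]; last by right; split; exact: iJ'.
    move=> [->|[Jb Jb']]; first by left.
    by right; split; exact: iJ.
have [||a pa] := @ultrafilter_square R p (principal_filter j) cR Up.
- by right; exists j.
- move=> S sS; rewrite principal_filterE => Sj; exists A, A;
  split => // u v Au Av.
  by apply: sS Sj; right; split => //; exact: AA.
case: (pselect (J a)) => Ja.
  apply: (filter_disjoint pA pa) => x Ax [ax|[_ Jx]]; last exact: AJ Ax Jx.
  by apply: AJ Ax _; rewrite -ax.
by apply: (pfree _ (finite_set1 a)); apply: filterS pa => b [->|[]].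
Qed.

(** Modulo [R] the elements with [per] form one zero class, and elsewhere powers of [x] become
    cancellable. An orbit [a * x^i] outside that class thus visits each class at most once, and its
    tail filter decides all classes. *)
Lemma projectively_closed_periodic (x : X) :
  exists i j : nat, [/\ (0 < i)%N, (0 < j)%N & pow x (i + j) = pow x i].
Proof.
pose per a := exists i j : nat, [/\ (0 < i)%N,
  (0 < j)%N & a * pow x (i + j) = a * pow x i].
have per_mul a b : per a -> per (b * a).
  by move=> [i [j [i0 j0 e]]]; exists i, j; split => //; rewrite -!mulgA e.
pose R (a b : X) := (exists2 i : nat, (0 < i)%N & a * pow x i = b * pow x i) \/
  per a /\ per b.
have eq_ge (a b : X) i k : (0 < i)%N -> (i <= k)%N ->
  a * pow x i = b * pow x i ->
    a * pow x k = b * pow x k.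
  move=> i0; rewrite leq_eqVlt => /orP[/eqP<-//|ik] e.
  by rewrite -(subnKC (ltnW ik)) powD ?subn_gt0 // !mulgA e.
have per_eq (a b : X) i : (0 < i)%N -> a * pow x i = b * pow x i -> per a ->
  per b.
  move=> i0 e [k [j [k0 j0 e']]]; exists (k + i)%N, j; split => //;
    first by rewrite addn_gt0 k0.
  have E c m : (0 < m)%N -> c * pow x (m + i) = c * pow x i * pow x m.
    by move=> m0; rewrite addnC powD // mulgA.
  by rewrite addnAC !E ?addn_gt0 ?k0 // -e !(mulgAC hcomm a (pow x i)) e'.
have cR : semigroup_congruence R.
  split.
  - by move=> a; left; exists 1%N.
  - by move=> a b [[i i0 e]|[]]; [left; exists i|right].
  - move=> a b c [[i i0 ab]|[pa pb]] [[k k0 bc]|[pb' pc]]; last by right.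
    + left; exists (maxn i k); first by rewrite leq_max i0.
      rewrite (eq_ge a b i) ?leq_maxl // (eq_ge b c k) ?leq_maxr //.
    + by right; split => //; apply: (per_eq b a i).
    + by right; split => //; apply: (per_eq b c k).
  - move=> a a' b b' [[i i0 ab]|[pa pa']] [[k k0 bc]|[pb pb']].
    + left; exists (i + k)%N; first by rewrite addn_gt0 i0.
      by rewrite powD // mulgACA // ab bc mulgACA.
    + by right; split; exact: per_mul.
    + by right; split; rewrite hcomm; exact: per_mul.
    + by right; split; exact: per_mul.
pose tl (a : X) : set_system X := [set A | exists2 k : nat, (0 < k)%N &
  forall i, (k <= i)%N -> A (a * pow x i)].
pose Q : set (set_system X) := [set F | exists a, F = tl a].
have Qproper F : Q F -> ProperFilter F.
  move=> [a ->]; apply: Build_ProperFilter_ex.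
    by move=> A [k k0 h]; exists (a * pow x k); exact: h.
  split.
  - by exists 1%N.
  - move=> A A' [k k0 h] [k' k'0 h']; exists (maxn k k');
    first by rewrite leq_max k0.
    by move=> i; rewrite geq_max => /andP[ki k'i]; split; [exact: h|exact: h'].
  - by move=> A A' AA' [k k0 h]; exists k => // i /h/AA'.
have per_ge (a : X) i : per a -> (0 < i)%N -> per (a * pow x i).
  by move=> pa i0; rewrite hcomm; exact: per_mul.
have per_of (a : X) i j : (0 < i)%N -> (i < j)%N ->
  R (a * pow x i) (a * pow x j) -> per a.
  move=> i0 ij [[k k0 e]|[[k [l [k0 l0 e]]] _]].
    exists (i + k)%N, (j - i)%N; split; rewrite ?addn_gt0 ?i0 ?subn_gt0 //.
    move: e; rewrite -!mulgA -!powD //; last exact: leq_trans ij.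
    by move=> e; rewrite e; congr (a * pow x _); lia.
  exists (i + k)%N, l; split; rewrite ?addn_gt0 ?i0 //.
  by move: e; rewrite -!mulgA -!powD ?addn_gt0 ?k0 // addnA.
have classQ F a : Q F -> F (R a) \/ F (~` R a).
  move=> [b ->]; case: (pselect (per b)) => pb.
    case: (pselect (per a)) => pa.
      by left; exists 1%N => // i i0; right; split => //; exact: per_ge.
    right; exists 1%N => // i i0 [[k k0 e]|[]//].
    by apply: pa; apply: (per_eq _ _ k k0 (esym e)); exact: per_ge.
  right; case: (pselect (exists2 i : nat, (0 < i)%N & R a (b * pow x i))) =>
    [[i i0 ai]|no].
    exists i.+1 => // j ij aj; apply: pb; apply: (per_of _ i j i0 ij).
    exact: (congruence_trans cR) (congruence_sym cR ai) aj.
  by exists 1%N => // i i0 ai; apply: no; exists i.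
(* Once an orbit enters this saturated set it stays there, so every tail filter decides it. *)
pose tail (a : X) k : set X := [set c | exists2 i,
  (k <= i)%N & R (a * pow x i) c].
have dec_tail a k : (0 < k)%N -> decidable_sets R Q (tail a k).
  move=> k0; split=> [b c bc [i ki ab]|_ [b ->]].
    by exists i => //; exact: (congruence_trans cR) ab bc.
  case: (pselect (exists2 j : nat, (0 < j)%N & tail a k (b * pow x j))) =>
    [[j j0 [i ki e]]|no].
    left; exists j => // l; rewrite leq_eqVlt => /orP[/eqP<-|jl];
      first by exists i.
    exists (i + (l - j))%N; first by rewrite (leq_trans ki) ?leq_addr.
    have i0 : (0 < i)%N by exact: leq_trans ki.
    rewrite powD ?subn_gt0 // mulgA -{2}(subnKC (ltnW jl)) powD ?subn_gt0 //
      mulgA.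
    exact: (congruence_mul cR e (congruence_refl cR _)).
  by right; exists 1%N => // j j0 h; apply: no; exists j.
have tail_tl a k : (0 < k)%N -> tl a (tail a k).
  by move=> k0; exists k => // i ki; exists i => //;
    exact: (congruence_refl cR).
have [||a [k k0 h]] := @projective_completion C hTz X R Q hcomm cR Qproper
  classQ _ _ proj
  (tl x) (ex_intro _ x erefl).
- move=> _ _ [a ->] [b ->]; exists (tl (a * b)); first by left; exists (a * b).
  move=> A [sA _] [k k0 h]; exists (tail a k), (tail b k); split;
    try exact: dec_tail;
    try exact: tail_tl.
  move=> u v [i ki au] [j kj bv]; apply: sA (congruence_mul cR au bv) _.
  have i0 : (0 < i)%N by exact: leq_trans ki.
  have j0 : (0 < j)%N by exact: leq_trans kj.
  by rewrite mulgACA // -powD //; apply: h; rewrite (leq_trans ki) ?leq_addr.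
- move=> a _ [b ->]; exists (tl (a * b)); first by left; exists (a * b).
  move=> A [sA _] [k k0 h]; exists (tail b k); split;
    [exact: dec_tail|exact: tail_tl|].
  move=> v [i ki bv]; apply: sA (congruence_mul cR (congruence_refl cR a) bv) _.
  by rewrite mulgA; exact: h.
have [i [j [i0 j0 e]]] : per x.
  apply: (per_of _ k k.+1 k0 (ltnSn k)).
  exact: (congruence_trans cR) (congruence_sym cR (h k (leqnn k))) (h _ (leqnSn
    k)).
by exists i.+1, j; split => //; rewrite addSn !powS ?addn_gt0 ?i0.
Qed.

End UltrafilterTranslates.

(** * Maximal subgroups and their exponents *)

Section Units.
Variable X : semigroupType.
Hypothesis hcomm : commutative (@mul X).
Implicit Types (a b c e f x y : X).

(** For an idempotent [e] of a commutative semigroup this is the maximal subgroup [H_e]; the witness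
    [b] may lie outside it, and [b * e] is then the inverse. *)
Definition units e : set X := [set a | a * e = a /\ exists b, a * b = e].

Lemma unit_id e : e * e = e -> units e e.
Proof. by move=> ee; split => //; exists e. Qed.

Lemma unitM e a b : units e a -> units e b -> units e (a * b).
Proof.
move=> [ae [a' aa']] [be [b' bb']]; split; first by rewrite -mulgA be.
exists (a' * b'); rewrite mulgACA // aa' bb'.
by rewrite -{1}aa' -mulgA (hcomm a') mulgA ae.
Qed.

Lemma unit_inv e a : e * e = e -> units e a -> exists2 b, units e b & a * b = e.
Proof.
move=> ee [ae [b ab]]; exists (b * e); last by rewrite mulgA ab.
split; first by rewrite -mulgA ee.
by exists a; rewrite hcomm mulgA ab.
Qed.

Lemma unit_idem e a : units e a -> a * a = a -> a = e.
Proof. by move=> [ae [b ab]] aa; rewrite -ae -ab mulgA aa. Qed.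

Lemma unit_cancel e a x y : units e a -> x * e = x -> y * e = y ->
  a * x = a * y -> x = y.
Proof.
move=> [ae [b ab]] xe ye axy; rewrite -xe -ye -ab !mulgA.
by rewrite (hcomm x) (hcomm y) axy.
Qed.

(** The non-units of the monoid [X e] form a prime ideal; this is what makes [unit_part] below a
    homomorphism. *)
Lemma unit_mulP e a b : e * e = e ->
  units e (a * b * e) <-> units e (a * e) /\ units e (b * e).
Proof.
move=> ee; have E : a * b * e = (a * e) * (b * e) by rewrite mulgACA // ee.
split=> [[_ [c]]|[ua ub]]; last by rewrite E; exact: unitM.
rewrite E => abc; split; (split; first by rewrite -mulgA ee).
  by exists (b * e * c); rewrite mulgA.
by exists (a * e * c); rewrite mulgCA // mulgA.
Qed.

Lemma unit_powP e a n : e * e = e -> (0 < n)%N ->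
  units e (pow a n * e) <-> units e (a * e).
Proof.
move=> ee; case: n => // n _; elim: n => // n IH.
rewrite powS // unit_mulP //; split=> [[]//|h]; by split => //; apply/IH.
Qed.

Lemma unit_pow e a n : (0 < n)%N -> units e a -> units e (pow a n).
Proof.
case: n => // n _ ua; elim: n => // n IH.
by rewrite powS //; exact: unitM.
Qed.

Lemma unit_pow_idem e a n : (0 < n)%N -> units e a ->
  pow a n * pow a n = pow a n -> pow a n = e.
Proof. by move=> n0 ua; apply: unit_idem; exact: unit_pow. Qed.

(** Only idempotents below [e] can see an element of [H_e] as a unit: the idempotent [e * f] is
    forced into [H_f]. *)
Lemma unit_le e f a : f * f = f -> e * e = e -> units e a -> units f (a * f) ->
  e * f = f.
Proof.
move=> ff ee [ae _]; rewrite -ae => /(unit_mulP _ _ ff)[_ uef].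
by apply: unit_idem uef _; rewrite mulgACA // ee ff.
Qed.

Lemma units_subgroup e : e * e = e -> is_subgroup (units e).
Proof.
move=> ee; split; first by move=> x y; exact: unitM.
exists e; first exact: unit_id.
move=> x ux; have [xe _] := ux; split => //; first by rewrite hcomm.
have [y uy xy] := unit_inv ee ux; exists y => //; split => //; by rewrite hcomm.
Qed.

Lemma subgroup_sub_units (G : set X) : is_subgroup G ->
  exists e, [/\ e * e = e, G e & G `<=` units e].
Proof.
move=> [_ [e Ge h]]; exists e; split => //; first by have [] := h e Ge.
move=> x Gx; have [_ xe [y _ [xy _]]] := h x Gx; split => //; by exists y.
Qed.

Lemma clifford_partP a : clifford_part a <-> exists2 e, e * e = e & units e a.
Proof.
split=> [[e [H [ee [sH He _] Ha]]]|[e ee ua]].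
  exists e => //; have [f [ff Hf HU]] := subgroup_sub_units sH.
  by rewrite (unit_idem (HU e He) ee); exact: HU.
exists e, (units e); split => //; split; [exact: units_subgroup|exact:
  unit_id|].
move=> G sG UG; rewrite eqEsubset; split => //.
have [f [ff Gf GU]] := subgroup_sub_units sG.
by rewrite (unit_idem (GU e (UG e (unit_id ee))) ee).
Qed.

(* The homomorphism from [X] onto the group [units e] with a zero adjoined. *)
Definition unit_part e a : option X :=
  if `[< units e (a * e) >] then Some (a * e) else None.

Lemma unit_part_some e a b : unit_part e a = Some b <-> units e b /\ a * e = b.
Proof.
rewrite /unit_part; case: ifP => [/asboolP ua|/asboolP nua]; split => //.
- by move=> [<-].
- by move=> [_ ->].
- by move=> [ub ab]; rewrite ab in nua.
Qed.

Lemma unit_part_none e a : unit_part e a = None <-> ~ units e (a * e).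
Proof. by rewrite /unit_part; case: ifP => /asboolP. Qed.

Lemma unit_part_congruence e : e * e = e ->
  semigroup_congruence (fun a b => unit_part e a = unit_part e b).
Proof.
move=> ee; apply: kernel_congruence => a a' b b'.
have E x y : unit_part e (x * y) =
    if unit_part e x is Some u then
      if unit_part e y is Some v then Some (u * v) else None
    else None.
  case ux : (unit_part e x) => [u|].
    case uy : (unit_part e y) => [v|].
      move/unit_part_some : ux => [uu xu]; move/unit_part_some : uy => [uv yv].
      apply/unit_part_some; split; first exact: unitM.
      by rewrite -xu -yv mulgACA // ee.
    apply/unit_part_none => /(unit_mulP _ _ ee)[_ uy'].
    by move/unit_part_none : uy; apply.
  apply/unit_part_none => /(unit_mulP _ _ ee)[ux' _].
  by move/unit_part_none : ux; apply.
by rewrite !E => -> ->.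
Qed.

End Units.

(** * Idempotent powers and bounded exponent of each maximal subgroup *)

Section Periodic.
Variables (C : topSemigroupType -> Prop) (X : semigroupType).
Hypothesis hTz : forall Y : topSemigroupType, TzS Y -> C Y.
Hypothesis hcomm : commutative (@mul X).
Hypothesis proj : projectively_C_closed C X.

Lemma projectively_closed_idempotent_power (x : X) :
  exists2 n, (0 < n)%N & pow x n * pow x n = pow x n.
Proof.
have [i [j [i0 j0 e]]] := projectively_closed_periodic hTz hcomm proj x.
have e1 k : (i <= k)%N -> pow x (k + j) = pow x k.
  rewrite leq_eqVlt => /orP[/eqP<-//|ik].
  have ki : (0 < k - i)%N by rewrite subn_gt0.
  by rewrite -(subnK (ltnW ik)) -addnA powD ?addn_gt0 ?i0 // e -powD.
have e2 k m : (i <= k)%N -> pow x (k + m * j) = pow x k.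
  move=> ik; elim: m => [|m IH]; first by rewrite addn0.
  by rewrite mulSn (addnC j) addnA e1 ?IH // (leq_trans ik) ?leq_addr.
(* A multiple of the period [j] that is at least [i]. *)
exists (i * j)%N; first by rewrite muln_gt0 i0.
by rewrite -powD ?muln_gt0 ?i0 // e2 // leq_pmulr.
Qed.

(** The new point is idempotent ([VM]), absorbs every element of [H_e] ([VK]) and stays away from
    each of them ([VnK], as the subgroups [K k] exhaust [H_e]). *)
Lemma projectively_closed_units_bounded (e : X) : e * e = e ->
  exists2 n, (0 < n)%N & forall a, units e a -> pow a n = e.
Proof.
move=> ee; apply: contrapT => nb.
have tors a : units e a -> exists2 n, (0 < n)%N & pow a n = e.
  move=> ua; have [n n0 an] := projectively_closed_idempotent_power a.
  by exists n => //; exact: unit_pow_idem an.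
have /choice[xi xiP] : forall n, exists x, (0 < n)%N ->
  units e x /\ pow x n <> e.
  move=> n; case: (posnP n) => [->|n0]; first by exists e.
  apply: contrapT => h; apply: nb; exists n => // a ua.
  by apply: contrapT => an; apply: h; exists a.
have /choice[o oP] : forall n, exists k, (0 < n)%N ->
  (0 < k)%N /\ pow (xi n) k = e.
  move=> n; case: (posnP n) => [->|n0]; first by exists 0%N.
  by have [u _] := xiP n n0; have [k k0 ke] := tors _ u; exists k.
(* The three factors make [N i.+1] a multiple of [N i], so that the subgroups [K i] grow; of an
   exponent killing [x i], so that [x i] falls into [K i.+1]; and of [i.+1], so that their union is
   [H_e]. *)
pose N := fix N i := if i is i.+1 then (N i * o ((N i * 2 ^ i)`!) * i.+1)%N
  else 1%N.
(* Every [m * N i] with [0 < m <= 2 ^ i] divides this factorial, so none of these powers of [x i] is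
   [e]. *)
pose x i := xi ((N i * 2 ^ i)`!).
have NS i : N i.+1 = (N i * o ((N i * 2 ^ i)`!) * i.+1)%N by [].
have N0 i : (0 < N i)%N.
  elim: i => // i IH; rewrite NS !muln_gt0 IH /= andbT.
  by have [] := oP _ (fact_gt0 (N i * 2 ^ i)).
have ux i : units e (x i) by have [] := xiP _ (fact_gt0 (N i * 2 ^ i)).
have xpow i m : (0 < m)%N -> (m <= 2 ^ i)%N -> pow (x i) (m * N i) <> e.
  move=> m0 mi h; have [_] := xiP _ (fact_gt0 (N i * 2 ^ i)); apply.
  rewrite -/(x i) -h; apply: pow_idem_dvd; rewrite ?fact_gt0 ?h ?ee //.
  by apply: dvdn_fact; rewrite muln_gt0 m0 N0 mulnC leq_mul2l mi orbT.
have Ndvd i j : (i <= j)%N -> (N i %| N j)%N.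
  elim: j => [|j IH]; first by rewrite leqn0 => /eqP->.
  rewrite leq_eqVlt => /orP[/eqP->//|]; rewrite ltnS => /IH h.
  by rewrite NS -mulnA dvdn_mulr.
have Nfact i : (0 < i)%N -> (i %| N i)%N by case: i => // i _;
  rewrite NS dvdn_mull.
pose K i : set X := [set g | units e g /\ pow g (N i) = e].
have KM i g g' : K i g -> K i g' -> K i (g * g').
  by move=> [ug gN] [ug' gN']; split; [exact: unitM|rewrite powMl // gN gN' ee].
have Kle i j : (i <= j)%N -> K i `<=` K j.
  move=> ij g [ug gN]; split => //; rewrite -gN.
  by apply: pow_idem_dvd; rewrite ?gN ?ee ?Ndvd.
have Kall g : units e g -> exists i, K i g.
  move=> ug; have [n n0 gn] := tors g ug; exists n; split => //; rewrite -gn.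
  by apply: pow_idem_dvd; rewrite ?gn ?ee ?N0 ?Nfact.
have Kx i j m : (i < j)%N -> (0 < m)%N -> K j (pow (x i) m).
  move=> ij m0; split; first exact: unit_pow.
  rewrite -powM // mulnC powM // -[RHS](@pow_idem _ e m) //; congr pow.
  have [o0 xo] := oP _ (fact_gt0 (N i * 2 ^ i)); rewrite -xo.
  apply: pow_idem_dvd => //; last by rewrite xo ee.
  by apply: dvdn_trans (Ndvd _ _ ij); rewrite NS -mulnA dvdn_mull // dvdn_mulr.
(* The sets [V k] will be the neighbourhoods of one new point at infinity. *)
pose V k : set X := [set g | exists i m u,
  [/\ (k <= i)%N, (0 < m)%N, (m * 2 ^ k <= 2 ^ i)%N,
    K i u & g = pow (x i) m * u]].
have Vu k g : V k g -> units e g.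
  by move=> [i [m [u [_ m0 _ [uu _] ->]]]]; apply: unitM => //; exact: unit_pow.
have VS k : V k.+1 `<=` V k.
  move=> g [i [m [u [ki m0 mi Ku ->]]]]; exists i, m, u; split => //;
    first exact: ltnW.
  by apply: leq_trans mi; rewrite leq_mul2l leq_exp2l // leqnSn orbT.
(* For indices [i < j] the factor of index [i] is absorbed into [K j]; for equal indices the
   exponents add. *)
have VM k g g' : V k.+1 g -> V k.+1 g' -> V k (g * g').
  have wlog_lt i j m m' u u' : (i < j)%N -> (k.+1 <= i)%N -> (0 < m)%N ->
      (m' * 2 ^ k.+1 <= 2 ^ j)%N -> (0 < m')%N -> K i u -> K j u' ->
      V k ((pow (x i) m * u) * (pow (x j) m' * u')).
    move=> ij ki m0 m'j m'0 Ku Ku'.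
    exists j, m', (pow (x i) m * u * u'); split => //.
    - by rewrite (leq_trans _ (ltnW ij)) // ltnW.
    - by apply: leq_trans m'j; rewrite leq_mul2l leq_exp2l // leqnSn orbT.
    - apply: (KM) => //; apply: KM; [exact: Kx|exact: Kle (ltnW ij) _ Ku].
    - by rewrite mulgCA // !mulgA.
  move=> [i [m [u [ki m0 mi Ku ->]]]] [j [m' [u' [kj m'0 m'j Ku' ->]]]].
  case: (ltngtP i j) => ij; first exact: wlog_lt.
    by rewrite hcomm; exact: wlog_lt.
  subst j; exists i, (m + m')%N, (u * u'); split.
  - exact: ltnW.
  - by rewrite addn_gt0 m0.
  - move: mi m'j; rewrite expnS; nia.
  - exact: KM.
  - by rewrite powD // mulgACA.
have VK k g h : K k g -> V k h -> V k (g * h).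
  move=> Kg [i [m [u [ki m0 mi Ku ->]]]]; exists i, m, (g * u); split => //.
    by apply: KM => //; exact: Kle Kg.
  exact: mulgCA.
have VnK k g : K k g -> ~ V k g.
  move=> Kg [i [m [u [ki m0 mi [uu uN] gE]]]].
  have [ug gN] := Kle _ _ ki _ Kg; apply: (xpow i m m0).
    by apply: leq_trans mi; rewrite leq_pmulr // expn_gt0.
  rewrite powM // -gN gE powMl // uN.
  by have [->] := unit_pow hcomm (N0 i) (unit_pow hcomm m0 (ux i)).
pose R a b := unit_part e a = unit_part e b.
have cR : semigroup_congruence R by exact: unit_part_congruence.
pose W k : set X := [set a | V k (a * e)].
pose F : set_system X := [set A | exists k, W k `<=` A].
have Vle k l : (k <= l)%N -> V l `<=` V k.
  by move=> /subnK <-; elim: (l - k)%N => // d IH; apply: subset_trans IH;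
    exact: VS.
have Vne k : V k (x k).
  exists k, 1%N, e; split => //; first by rewrite mul1n.
    by split; [exact: unit_id|rewrite pow_idem].
  by have [->] := ux k.
pose Q : set (set_system X) := [set F].
have Qproper G : Q G -> ProperFilter G.
  move=> ->; apply: Build_ProperFilter_ex.
    by move=> A [k]; move=> /(_ (x k)) h; exists (x k); apply: h;
      rewrite /W /=; have [-> _] := ux k.
  split; first by exists 0%N.
    move=> A A' [k WA] [l WA']; exists (maxn k l) => a Wa; split.
      by apply: WA; apply: Vle Wa; exact: leq_maxl.
    by apply: WA'; apply: Vle Wa; exact: leq_maxr.
  by move=> A A' AA' [k WA]; exists k; exact: subset_trans AA'.
have nFclass a : F (~` R a).
  case: (pselect (units e (a * e))) => ua; last first.
    exists 0%N => b Wb ab; apply: ua.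
    have /unit_part_some ub : units e (b * e) /\ b * e = b * e by split => //;
      exact: Vu Wb.
    by move: ub; rewrite -ab => /unit_part_some[h ->].
  have [i Ki] := Kall _ ua; exists i => b Wb ab; apply: (VnK i _ Ki).
  have /unit_part_some : units e (a * e) /\ a * e = a * e by [].
  by rewrite ab => /unit_part_some[_ <-].
have classQ G a : Q G -> G (R a) \/ G (~` R a) by move=> ->; right.
have dW k : decidable_sets R Q (W k).
  split; last by move=> _ ->; left; exists k.
  move=> a b ab Wa; have /unit_part_some ua : units e (a * e) /\ a * e = a * e.
    by split => //; exact: Vu Wa.
  by move: ua; rewrite ab => /unit_part_some[_ be]; rewrite /W /= be.
have FW k : F (W k) by exists k.
have [||a] := @projective_completion C hTz X R Q hcomm cR Qproper classQ _ _
  proj F erefl.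
- move=> _ _ -> ->; exists F; first by left.
  move=> A dA [k WA]; exists (W k.+1), (W k.+1); split => //.
  by move=> u v Wu Wv; apply: WA; rewrite /W /= -ee mulgACA //; exact: VM.
- move=> a _ ->; case: (pselect (units e (a * e))) => ua.
    exists F; first by left.
    move=> A dA [k WA]; have [i Ki] := Kall _ ua.
    exists (W (maxn i k)); split => // v Wv; apply: WA;
      apply: (Vle _ (maxn i k)).
      exact: leq_maxr.
    rewrite -ee mulgACA //; apply: VK => //; apply: Kle Ki; exact: leq_maxl.
  (* Here [a] lies in the zero class of the quotient, which swallows every product. *)
  exists (principal_filter a); first by right; exists a.
  move=> A [sA _]; rewrite principal_filterE => Aa.
  have FT : F setT by exists 0%N.
  exists setT; split => //; first by split => // G ->; left.
  move=> v _; apply: sA Aa.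
  have /unit_part_none n : ~ units e (a * e) by [].
  rewrite /R n; symmetry; apply/unit_part_none.
  by move=> /(unit_mulP hcomm _ _ ee)[].
have FF := Qproper F erefl; move=> Fa; apply: (filter_disjoint Fa (nFclass a)).
by move=> b /= ab; apply.
Qed.

End Periodic.

(** * Finiteness of subgroups *)

Section ElementaryGroups.
Variables (X : semigroupType) (e : X) (p : nat) (S : set X).
Hypothesis hcomm : commutative (@mul X).
Hypothesis ee : e * e = e.
Hypothesis p_prime : prime p.
Hypothesis Sunits : S `<=` units e.
Hypothesis Spow : forall a, S a -> pow a p = e.

(** A subgroup of [S]: inverses are powers, because [S] has exponent [p]. *)
Definition closed_subset (N : set X) :=
  [/\ N `<=` S, N e & forall a b, N a -> N b -> N (a * b)].

Definition coset (s : X) (N : set X) : set X := [set g | exists2 u,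
  N u & g = s * u].

(* Every ultrafilter on [S] contains a coset of [N] exactly when [N] has finite
   index in [S]; this form is stable under intersections at no cost. *)
Definition finite_index (N : set X) :=
  forall q : set_system X, UltraFilter q -> q S ->
    exists2 s, S s & q (coset s N).

Lemma S_id a : S a -> a * e = a.
Proof. by move=> /Sunits[]. Qed.

Lemma closed_subset_pow N a n : closed_subset N -> N a -> N (pow a n).
Proof.
move=> [_ Ne NM] Na; case: n => // n; elim: n => // n IH.
by rewrite powS //; exact: NM.
Qed.

Lemma closed_subset_inv N a : closed_subset N -> N a ->
  exists2 b, N b & b * a = e.
Proof.
move=> cN Na; exists (pow a p.-1); first exact: closed_subset_pow.
have [NS _ _] := cN; rewrite hcomm -powS;
  last by rewrite -ltnS prednK ?prime_gt1 ?prime_gt0.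
by rewrite prednK ?prime_gt0 // Spow //; exact: NS.
Qed.

Lemma closed_subsetI N M : closed_subset N -> closed_subset M ->
  closed_subset (N `&` M).
Proof.
move=> [NS Ne NM] [MS Me MM]; split => //; first by move=> x [/NS].
by move=> a b [Na Ma] [Nb Mb]; split; [exact: NM|exact: MM].
Qed.

Hypothesis Sclosed : closed_subset S.

Lemma coset_self s M : closed_subset M -> S s -> coset s M s.
Proof. by move=> [_ Me _] Ss; exists e => //; rewrite S_id. Qed.

(** A point [t] common to the two cosets turns them into the cosets of [t], which intersect in the
    coset of [t] by the intersection. *)
Lemma finite_indexI N M : closed_subset N -> closed_subset M ->
  finite_index N -> finite_index M -> finite_index (N `&` M).
Proof.
move=> cN cM fN fM q Uq qS.
have [s Ss qs] := fN q Uq qS; have [s' Ss' qs'] := fM q Uq qS.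
have qi : q (S `&` (coset s N `&` coset s' M)).
  by apply: filterI => //; exact: filterI.
have [t [St [[v Nv tv] [v' Mv' tv']]]] := filter_ex qi.
exists t => //; apply: filterS qi => x [Sx [[u Nu xu] [u' Mu' xu']]].
have [b Sb bt] := closed_subset_inv Sclosed St.
exists (b * x); last by rewrite (mulgA t b x) (hcomm t b) bt (hcomm e x) (S_id
  Sx).
have bs v0 u0 s0 : S s0 -> t = s0 * v0 -> x = s0 * u0 -> S v0 -> S u0 ->
    forall w, w * v0 = e -> b * x = w * u0.
  move=> Ss0 tE xE Sv0 Su0 w wv.
  apply: (unit_cancel hcomm (Sunits St)).
  - by rewrite -mulgA (S_id Sx).
  - by rewrite -mulgA (S_id Su0).
  - rewrite (mulgA t b x) (hcomm t b) bt (hcomm e x) (S_id Sx) xE tE.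
    by rewrite mulgA -(mulgA s0 v0 w) (hcomm v0 w) wv (S_id Ss0).
have [NS _ NM] := cN; have [MS _ MM] := cM.
split.
  have [w Nw wv] := closed_subset_inv cN Nv.
  by rewrite (bs v u s Ss tv xu (NS _ Nv) (NS _ Nu) w wv); exact: NM.
have [w Mw wv] := closed_subset_inv cM Mv'.
by rewrite (bs v' u' s' Ss' tv' xu' (MS _ Mv') (MS _ Mu') w wv); exact: MM.
Qed.

(** Take [M] maximal among the subgroups that contain [K] and avoid [s]. Adjoining any [t] outside
    [M] captures [s = m * t^j] with [j] prime to [p], so [t] lies in a coset of [M] by one of the
    finitely many powers of [s]. *)
Lemma maximal_subgroup_index K s : closed_subset K -> S s -> ~ K s ->
  exists M, [/\ closed_subset M, K `<=` M, ~ M s & finite_index M].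
Proof.
move=> cK Ss nKs.
pose P : set (set X) := [set A | A = set0 \/ [/\ closed_subset A,
  K `<=` A & ~ A s]].
have [|M [PM maxM]] := @Zorn_bigcup X P.
  move=> F FP Ftot; case: (pselect (exists2 A, F A & A !=set0)) =>
    [[A FA [a Aa]]|no]; last first.
    left; rewrite -subset0 => x [A FA Ax]; apply: no; exists A => //;
      by exists x.
  have ne B b : F B -> B b -> [/\ closed_subset B, K `<=` B & ~ B s].
    by move=> FB Bb; case: (FP B FB) => // B0; rewrite B0 in Bb.
  have [[AS Ae AM] KA nAs] := ne A a FA Aa.
  right; split.
  - split.
    + by move=> x [B FB Bx]; have [[BS _ _] _ _] := ne B x FB Bx; exact: BS.
    + by exists A.
    + move=> x y [B FB Bx] [B' FB' By].
      have [[_ _ BM] _ _] := ne B x FB Bx;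
        have [[_ _ BM'] _ _] := ne B' y FB' By.
      case: (Ftot B B' FB FB') => h.
        by exists B' => //; apply: BM' => //; exact: (h x Bx).
      by exists B => //; apply: BM => //; exact: (h y By).
  - by move=> x Kx; exists A => //; exact: KA.
  - by move=> [B FB Bs]; have [_ _] := ne B s FB Bs.
have {PM} [cM KM nMs] : [/\ closed_subset M, K `<=` M & ~ M s].
  case: PM => // M0; case: (maxM K); last by right; split.
  split; last by rewrite M0 => /(_ e); apply; have [] := cK.
  by rewrite M0; exact: sub0set.
exists M; split => //.
have [MS Me MM] := cM; have [_ Se SM] := Sclosed.
have p0 := prime_gt0 p_prime; have p1 := prime_gt1 p_prime.
(* Exponents go up to [p] included: the trivial power is [pow s p], as [pow s 0] is [s]. *)
have key t : S t -> exists2 l, `I_p.+1 l & coset (pow s l) M t.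
  move=> St; case: (pselect (M t)) => Mt.
    by exists p => /=; rewrite ?ltnS //; exists t => //;
      rewrite Spow // hcomm S_id.
  pose M' : set X := [set g | exists m j, [/\ M m,
    (0 < j)%N & g = m * pow t j]].
  have cM' : closed_subset M'.
    split.
    - move=> _ [m [j [Mm j0 ->]]]; apply: SM; first exact: MS.
      exact: closed_subset_pow.
    - by exists e, p; rewrite Spow.
    - move=> _ _ [m [j [Mm j0 ->]]] [m' [j' [Mm' j'0 ->]]].
      exists (m * m'), (j + j')%N; split; [exact: MM|by rewrite addn_gt0 j0|].
      by rewrite powD // mulgACA.
  have MM' : M `<=` M'.
    by move=> m Mm; exists m, p; split => //; rewrite Spow // S_id //;
      exact: MS.
  have M't : M' t by exists e, 1%N; split => //; rewrite hcomm S_id.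
  have [m [j [Mm j0 sE]]] : M' s.
    apply: contrapT => nM's; apply: (maxM M').
      by split => // /(_ t M't).
    by right; split => //; exact: subset_trans MM'.
  have powp k : (0 < k)%N -> pow t (p * k) = e.
    by move=> k0; rewrite powM // Spow // pow_idem.
  have cpj : coprime j p.
    rewrite coprime_sym prime_coprime //; apply/negP => /dvdnP[k jE].
    have k0 : (0 < k)%N by move: j0; rewrite jE muln_gt0 => /andP[].
    by apply: nMs; rewrite sE jE mulnC powp // S_id //; exact: MS.
  case: (egcdnP p j0) => l k lE _; rewrite (eqP cpj) in lE.
  have l0 : (0 < l)%N by case: l lE => //; rewrite mul0n addn1.
  have tl : pow t (j * l) = t.
    rewrite mulnC lE; case: k {lE} => [|k]; first by rewrite mul0n.
    by rewrite powD ?muln_gt0 ?p0 // mulnC powp // hcomm S_id.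
  have sl : pow s l = pow m l * t by rewrite sE powMl // -powM // tl.
  have [w Mw wm] := closed_subset_inv cM (closed_subset_pow l cM Mm).
  have sp n : (0 < n)%N -> pow s (n + p) = pow s n.
    by move=> n0; rewrite powD // Spow // S_id //; exact: closed_subset_pow.
  have [l' l'p sl'] : exists2 l', `I_p.+1 l' & pow s l' = pow s l.
    exists ((l.-1 %% p).+1); first by rewrite /= ltnS ltn_mod.
    rewrite -[in RHS](prednK l0) [in RHS](divn_eq l.-1 p).
    elim: (l.-1 %/ p)%N => [|d IH]; first by rewrite mul0n.
    by rewrite IH mulSn -[LHS]sp //; congr pow; lia.
  exists l' => //; rewrite sl' sl; exists w => //.
  by rewrite mulgAC // (hcomm _ w) wm hcomm S_id.
move=> q Uq qS.
have /choice[l lP] : forall t, exists l, S t ->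
  `I_p.+1 l /\ coset (pow s l) M t.
  move=> t; case: (pselect (S t)) => [/key[l h1 h2]|n]; first by exists l.
  by exists 0%N.
have [|c _ qc] := @ultra_finite _ _ q _ l `I_p.+1 (finite_II _).
  by apply: filterS qS => t /lP[].
exists (pow s c); first exact: closed_subset_pow.
by apply: filterS (filterI qS qc) => t [/lP[_ h] <-].
Qed.

(** Translation by [N] is confined to [X e], where [e] is neutral; other elements stay alone, since
    [e] itself would move them. *)
Definition translation_rel (N : set X) (a b : X) :=
  a = b \/ a * e = a /\ exists2 g, N g & b = g * a.

Lemma translation_congruence N : closed_subset N ->
  semigroup_congruence (translation_rel N).
Proof.
move=> cN; have [NS Ne NM] := cN; split.
- by left.
- move=> a b [->|[ae [g Ng ->]]]; first by left.
  right; split; first by rewrite -mulgA ae.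
  have [h Nh hg] := closed_subset_inv cN Ng; exists h => //.
  by rewrite mulgA hg hcomm ae.
- move=> a b c [->//|[ae [g Ng ->]]] [<-|[_ [h Nh ->]]]; right; split => //.
    by exists g.
  by exists (h * g); [exact: NM|rewrite mulgA].
- move=> a a' b b' [<-|[ae [g Ng ->]]] [<-|[be [h Nh ->]]]; first by left.
  + by right; split; [rewrite -mulgA be|exists h => //; rewrite mulgCA].
  + by right; split; [rewrite mulgAC // ae|exists g => //; rewrite mulgA].
  + right; split; first by rewrite -mulgA be.
    by exists (g * h); [exact: NM|rewrite mulgACA].
Qed.

Variable f : nat -> X.
Hypothesis fS : forall i, S (f i).
Hypothesis Sf : forall a, S a -> exists i, a = f i.
Hypothesis Sinf : infinite_set S.

Definition index_state (x : X * set X) :=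
  [/\ S x.1, closed_subset x.2 & finite_index x.2].

(** A subgroup of finite index in the infinite [S] is nontrivial, so its coset has a point [a']
    other than [f i]; a finite-index subgroup missing the quotient of [f i] by [a'] separates the
    two. *)
Lemma avoid_point i (x : X * set X) : index_state x -> exists y,
  [/\ index_state y, y.2 `<=` x.2, coset x.1 x.2 y.1 & ~ coset y.1 y.2 (f i)].
Proof.
case: x => a N [/= Sa cN fN]; have [NS Ne NM] := cN; have [_ Se SM] := Sclosed.
have [u Nu ue] : exists2 u, N u & u <> e.
  apply: contrapT => no; have [q [Uq qS qfree]] := free_ultrafilter Sinf.
  have [s Ss qs] := fN q Uq qS; apply: (qfree _ (finite_set1 (s * e))).
  apply: filterS qs => _ [u Nu ->] /=; congr (s * _).
  by apply: contrapT => ue; apply: no; exists u.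
have [a' [v Nv a'E] a'f] : exists2 a', coset a N a' & a' <> f i.
  case: (pselect (a = f i)) => af; last by exists a => //; exact: coset_self.
  exists (a * u); first by exists u.
  rewrite -af => au; apply: ue.
  apply: (unit_cancel hcomm (Sunits Sa)) => //; first by rewrite S_id //;
    exact: NS.
  by rewrite au S_id.
have Sa' : S a' by rewrite a'E; apply: SM => //; exact: NS.
have [b Sb ba] := closed_subset_inv Sclosed Sa'.
have c1 : closed_subset [set e].
  by split => //; [move=> _ ->|move=> _ _ -> ->].
have [||M [cM _ nM fM]] := @maximal_subgroup_index [set e] (b * f i) c1.
- exact: SM.
- move=> /= h; apply: a'f.
  by rewrite -(S_id Sa') -h mulgA (hcomm a') ba hcomm S_id.
exists (a', N `&` M); split => //=.
- by split => //=; [exact: closed_subsetI|exact: finite_indexI].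
- by exists v.
- move=> [w [_ Mw] fE]; apply: nM; rewrite fE mulgA ba hcomm S_id //.
  by have [h _ _] := cM; exact: h.
Qed.

(** Countability lets nested cosets avoid every element of [S] in turn: their intersection is empty,
    yet an ultrafilter containing them all is Cauchy. *)
Lemma countable_elementary_not_closed (C : topSemigroupType -> Prop) :
  (forall Y : topSemigroupType, TzS Y -> C Y) -> ~ injectively_C_closed C X.
Proof.
move=> hTz inj; have [_ Se SM] := Sclosed.
have fiS : finite_index S.
  move=> q Uq qS; exists e => //; apply: filterS qS => x Sx.
  by exists x => //; rewrite hcomm S_id.
pose T := {x : X * set X | index_state x}.
pose r (s t : nat * T) := [/\ t.1 = s.1.+1, (sval t.2).2 `<=` (sval s.2).2,
  coset (sval s.2).1 (sval s.2).2 (sval t.2).1 &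
  ~ coset (sval t.2).1 (sval t.2).2 (f s.1)].
have rex s : {t | r s t}.
  apply: cid; case: s => i [x xP]; have [y [yP h1 h2 h3]] := avoid_point i xP.
  by exists (i.+1, exist _ y yP).
have s0P : index_state (e, S) by split.
have [g [g0 gS]] := dependent_choice rex (0%N, exist _ _ s0P).
pose a i := (sval (g i).2).1; pose N i := (sval (g i).2).2.
have gi i : (g i).1 = i by elim: i => [|i IH];
  [rewrite g0|have [-> _ _ _] := gS i; rewrite IH].
have st i : index_state (a i, N i) by have := svalP (g i).2; rewrite /a /N;
  case: (sval _).
have Nsub i : N i.+1 `<=` N i by have [] := gS i.
have acos i : coset (a i) (N i) (a i.+1) by have [] := gS i.
have nf i : ~ coset (a i.+1) (N i.+1) (f i) by have [_ _ _] := gS i; rewrite gi.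
have csub i : coset (a i.+1) (N i.+1) `<=` coset (a i) (N i).
  have [_ [_ _ NM] _] := st i.
  move=> _ [u Nu ->]; have [v Nv ->] := acos i; exists (v * u);
    last by rewrite mulgA.
  by apply: NM => //; exact: Nsub.
have cle i j : (i <= j)%N -> coset (a j) (N j) `<=` coset (a i) (N i).
  by move=> /subnK <-; elim: (j - i)%N => // d IH; apply: subset_trans IH;
    exact: csub.
pose F : set_system X := [set A | exists i, coset (a i) (N i) `<=` A].
have FF : ProperFilter F.
  apply: Build_ProperFilter_ex.
    move=> A [i h]; exists (a i); apply: h.
    by have [Sa cN _] := st i; exact: coset_self.
  split; first by exists 0%N.
    move=> A A' [i h] [j h']; exists (maxn i j) => x cx; split.
      by apply: h; apply: cle cx; exact: leq_maxl.
    by apply: h'; apply: cle cx; exact: leq_maxr.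
  by move=> A A' AA' [i h]; exists i; exact: subset_trans AA'.
have [q [Uq Fq]] := ultraFilterLemma FF.
have qc i : q (coset (a i) (N i)) by apply: Fq; exists i.
have cS i : coset (a i) (N i) `<=` S.
  have [Sa [NS _ _] _] := st i; move=> _ [u Nu ->]; apply: SM => //; exact: NS.
have qS : q S by apply: filterS (qc 0%N).
(* With the trivial algebra the topology comes from the congruences alone. *)
pose B : set (set X) := [set A | A = set0 \/ A = setT].
pose P : set (set_system X) := [set F | ProperFilter F].
have cBP : completion B P.
  split.
  - by right.
  - by move=> A [->|->]; [right; rewrite setC0|left; rewrite setCT].
  - by move=> A A' [->|->] BA'; [left; rewrite set0I|rewrite setTI].
  - by [].
  - by move=> G A PG [->|->]; [right; rewrite setC0|left];
    exact: (@filterT _ G (PG : ProperFilter G)).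
  - by move=> b; exact: principal_filter_proper.
  - move=> G H PG PH; have GF : ProperFilter G by [];
    have HF : ProperFilter H by [].
    exists H => // A [->|->] HA; first by case: (@filter_set0 _ H HF HA).
    by exists setT, setT; split; [right|right|exact: (@filterT _ G)|exact:
      (@filterT _ H)|].
pose R : set (X -> X -> Prop) := [set r | exists M,
  [/\ closed_subset M, finite_index M & r = translation_rel M]].
have RN M : closed_subset M -> finite_index M -> R (translation_rel M).
  by move=> cM fM; exists M.
have [|||||b [qb _]] := cauchy_point cBP (N := R) _ _ _ hTz inj _ (F := q).
- by move=> _ [M [cM _ ->]]; exact: translation_congruence.
- by exists (translation_rel S); exact: RN.
- move=> _ _ [M [cM fM ->]] [M' [cM' fM' ->]].
  exists (translation_rel (M `&` M')).
    by apply: RN; [exact: closed_subsetI|exact: finite_indexI].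
  move=> c d [->|[ce [k [Mk M'k] ->]]]; first by split; left.
  by split; right; split => //; exists k.
- move=> c d cd; case: (pselect (translation_rel S c d)) =>
  [[//|[ce [s Ss dE]]]|n]; last first.
    by exists (translation_rel S) => //; exact: RN.
  (* To separate [c] from [s * c], a finite-index subgroup must contain the stabiliser of [c] but
     not [s]. *)
  pose K : set X := [set k | S k /\ k * c = c].
  have cK : closed_subset K.
    split; first by move=> k [].
      by split => //; rewrite hcomm.
    by move=> k k' [Sk kc] [Sk' k'c]; split; [exact: SM|rewrite -mulgA k'c].
  have [|M [cM KM nM fM]] := @maximal_subgroup_index K s cK Ss.
    by move=> [_ sc]; apply: cd; rewrite dE.
  exists (translation_rel M); first exact: RN.
  move=> [//|[_ [k Mk kE]]]; apply: nM; have [MS Me MM] := cM.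
  have [w Mw wk] := closed_subset_inv cM Mk.
  have Sk := MS _ Mk; have Sw := MS _ Mw.
  have -> : s = k * (w * s) by rewrite mulgA (hcomm k) wk hcomm S_id.
  apply: MM => //; apply: KM; split; first exact: SM.
  by rewrite -mulgA -dE kE mulgA wk hcomm.
- split; first exact: ultra_proper.
    move=> _ [M [cM fM ->]]; have [s Ss qs] := fM q Uq qS; exists s.
    apply: filterS qs => _ [u Mu ->]; right; split; first exact: S_id.
    by exists u => //; rewrite hcomm.
  by exists q => //; exact: ultra_proper.
have bc i : coset (a i) (N i) b.
  have [Sa cN fN] := st i; have [NS Ne NM] := cN.
  have [t [[<-//|[be [k Nk ->]]] [u Nu tE]]]
    := filter_ex (filterI (qb _ (RN _ cN fN)) (qc i)).
  have [w Nw wk] := closed_subset_inv cN Nk.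
  exists (w * u); first exact: NM.
  by rewrite mulgCA // -tE mulgA wk hcomm.
have [i bi] := Sf (cS 0%N _ (bc 0%N)).
by apply: (nf i); rewrite -bi.
Qed.

End ElementaryGroups.

(** * Finiteness of torsion: from prime exponent to any exponent *)

Section GroupFinite.
Variables (C : topSemigroupType -> Prop) (X : semigroupType).
Hypothesis hTz : forall Y : topSemigroupType, TzS Y -> C Y.
Hypothesis hcomm : commutative (@mul X).
Hypothesis inj : injectively_C_closed C X.

(** An infinite set of such elements contains the countable group generated by a sequence; its
    elements are values of finite words, which [pickle] enumerates. *)
Lemma units_prime_torsion_finite (e : X) p : e * e = e -> prime p ->
  finite_set [set a | units e a /\ pow a p = e].
Proof.
move=> ee pp; apply: contrapT => Einf; set E := [set a | _] in Einf.
have [t [tE tinj]] := infinite_sequence Einf.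
pose F w := foldr (fun i z => t i * z) e w.
have EM a b : E a -> E b -> E (a * b).
  by move=> [ua ap] [ub bp]; split; [exact: unitM|rewrite powMl // ap bp].
have Ee : E e by split; [exact: unit_id|rewrite pow_idem].
have FE w : E (F w) by elim: w => //= i w IH; exact: EM.
have Fcat w w' : F (w ++ w') = F w * F w'.
  elim: w => /= [|i w ->]; last by rewrite mulgA.
  by have [[h _] _] := FE w'; rewrite hcomm.
pose f n := F (odflt [::] (unpickle n)).
have fF w : f (pickle w) = F w by rewrite /f pickleK.
pose S : set X := range F.
have SE a : S a -> E a by move=> [w _ <-].
apply: (@countable_elementary_not_closed X e p S hcomm ee pp _ _ _ f _ _ _ C
  hTz inj).
- by move=> a /SE[].
- by move=> a /SE[].
- split => //; first by exists [::].
  by move=> _ _ [w _ <-] [w' _ <-]; exists (w ++ w').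
- by move=> i; exists (odflt [::] (unpickle i)).
- by move=> _ [w _ <-]; exists (pickle w).
- apply: (sequence_infinite _ tinj) => i; exists [:: i] => //=.
  by have [[h _] _] := tE i.
Qed.

(** For a prime factor [p] of [m], the [p]-th power map takes finitely many values by induction, and
    elements with the same value differ by one of exponent [p]. *)
Lemma units_torsion_finite (e : X) m : e * e = e -> (0 < m)%N ->
  finite_set [set a | units e a /\ pow a m = e].
Proof.
move=> ee; elim/ltn_ind: m => m IH m0; apply: contrapT => Minf.
have m1 : (1 < m)%N.
  rewrite ltn_neqAle m0 andbT; apply/eqP => m1; apply: Minf; rewrite -m1.
  by apply: (sub_finite_set _ (finite_set1 e)) => a [_ /= ->].
have [q [Uq qM qfree]] := free_ultrafilter Minf.
pose p := pdiv m; have pp : prime p := pdiv_prime m1.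
have p0 := prime_gt0 pp.
have mE : m = (p * (m %/ p))%N by rewrite mulnC divnK ?pdiv_dvd.
have m'0 : (0 < m %/ p)%N by rewrite divn_gt0 // pdiv_leq.
have m'm : (m %/ p < m)%N by rewrite ltn_Pdiv ?prime_gt1.
have [|c _ qc] := @ultra_finite _ _ q _ (fun a => pow a p) _ (IH _ m'm m'0).
  apply: filterS qM => a [ua am]; split; first exact: unit_pow.
  by rewrite -powM // -mE.
have [a [[ua am] ac]] := filter_ex (filterI qM qc).
have [b ub ab] := unit_inv hcomm ee ua.
have [|d _ qd] := @ultra_finite _ _ q _ (fun t =>
  t * b) _ (units_prime_torsion_finite ee pp).
  apply: filterS (filterI qM qc) => t [[ut tm] tc]; split; first exact: unitM.
  by rewrite powMl // tc -ac -powMl // ab pow_idem.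
apply: (qfree _ (finite_set1 (d * a))); apply: filterS (filterI qM qd) =>
  t [[[te _] _] <-] /=.
by rewrite -mulgA (hcomm b) ab te.
Qed.

End GroupFinite.

(** * Finiteness of the complement of the Clifford part *)

(** A state pairs a chosen number with a [U]-large set of admissible successors; these sets shrink,
    so each term is admissible for all earlier ones. *)
Lemma ramsey_sequence (U : set_system nat) (c : nat -> nat -> Prop) :
    UltraFilter U -> (forall D, finite_set D -> ~ U D) ->
    U [set n | U [set m | c n m]] ->
  exists g : nat -> nat, forall i j, (i < j)%N ->
    (g i < g j)%N /\ c (g i) (g j).
Proof.
move=> UU Ufree Uc.
pose ok (x : nat * set nat) := U x.2 /\ forall m, x.2 m ->
  (x.1 < m)%N /\ c x.1 m.
have gt n : U [set m | (n < m)%N].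
  suff -> : [set m | (n < m)%N] = ~` `I_n.+1 by apply: ultra_setC;
    apply: Ufree; exact: finite_II.
  by rewrite eqEsubset; split => m /=; rewrite ltnS; lia.
pose T := {x : nat * set nat | ok x}.
pose r (s t : T) := (sval s).2 (sval t).1 /\ (sval t).2 `<=` (sval s).2.
have step (A : set nat) : U A -> exists y : T,
  A (sval y).1 /\ (sval y).2 `<=` A.
  move=> UA; have [n [An Un]] := filter_ex (filterI UA Uc).
  have okn : ok (n, A `&` ([set m | (n < m)%N] `&` [set m | c n m])).
    split; last by move=> m [_ []].
    by apply: filterI => //; apply: filterI => //; exact: gt.
  by exists (exist _ _ okn); split => // m [].
have [s0 _] := step setT filterT.
have rex s : {t | r s t}.
  apply: cid; case: s => -[n A] [/= UA nA]; have [y [h1 h2]] := step A UA.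
  by exists y; split.
have [g [_ gS]] := dependent_choice rex s0.
pose G i := (sval (g i)).1.
have sub i j : (i <= j)%N -> (sval (g j)).2 `<=` (sval (g i)).2.
  move=> /subnK <-; elim: (j - i)%N => // d IH; apply: subset_trans IH.
  by have [] := gS (d + i)%N.
exists G => i j ij; have [_ h] := svalP (g i); apply: h.
case: j ij => // j; rewrite ltnS => ij; apply: (sub _ _ ij).
by have [] := gS j.
Qed.

Section CliffordFinite.
Variable X : semigroupType.
Hypothesis hcomm : commutative (@mul X).
Hypothesis chainX : chain_finite X.

(** If comparability [c] were typical for [U], a subsequence would be an infinite chain; so
    incomparability is typical. *)
Lemma antichain_sequence (e : nat -> X) : (forall n, e n * e n = e n) ->
    (forall n, finite_set [set m | e m = e n]) ->
  exists g : nat -> nat, (forall i j, (i < j)%N -> (g i < g j)%N) /\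
    forall i j, e (g i) * e (g j) = e (g j) -> i = j.
Proof.
move=> ee efin; have [U [UU _ Ufree]] := free_ultrafilter infinite_nat.
pose c n m := [set e n; e m] (e n * e m).
have [Uc|Uc] := in_ultra_setVsetC [set n | U [set m | c n m]] UU.
  have [|g gP] := @ramsey_sequence U (fun n m => e m <> e n /\ c n m) UU Ufree.
    apply: filterS Uc => n Un; apply: filterI => //.
    by apply: (@ultra_setC _ U UU [set m | e m = e n]); exact: Ufree.
  exfalso; pose h i := e (g i).
  have hinj : injective h.
    move=> i j hij; case: (ltngtP i j) => // /gP[_ [ne _]]; first by case: ne.
    by case: ne; rewrite -/(h i) hij.
  have hc i j : [set h i; h j] (h i * h j).
    case: (ltngtP i j) => [/gP[_ []]//|ji|->]; last by left; exact: ee.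
    by have [_ [_ []]] := gP _ _ ji; rewrite hcomm => ->; [right|left].
  have [x [y [[i _ <-] [j _ <-]]]] := chainX (sequence_infinite (t := h) (A :=
    range h)
    (fun i => ex_intro2 _ _ i I erefl) hinj).
  by apply; exact: hc.
have [|g gP] := @ramsey_sequence U (fun n m => ~ c n m) UU Ufree.
  apply: filterS Uc => n Un; exact: ultra_setC.
exists g; split => [i j /gP[]//|i j eij].
case: (ltngtP i j) => // /gP[_]; first by case; right.
by case; left; rewrite hcomm.
Qed.

Hypothesis squares : forall J A : set X, semigroup_ideal J -> J !=set0 ->
  (forall a, A a -> ~ J a) -> (forall a b, A a -> A b -> J (a * b)) ->
    finite_set A.

Lemma semigroup_idealU (J J' : set X) : semigroup_ideal J ->
  semigroup_ideal J' ->
  semigroup_ideal (J `|` J').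
Proof. by move=> iJ iJ' a b [Jb|Jb]; [left; exact: iJ|right; exact: iJ']. Qed.

(** Outside [J], the part of [a X] inside [a^2 X] is finite by induction, and products of two
    elements of the rest lie in [a^2 X], so [squares] applies modulo [J']. *)
Lemma nil_principal_finite (J : set X) k a : semigroup_ideal J ->
  J (pow a (2 ^ k)) -> finite_set [set x | ~ J x /\ exists y, x = a * y].
Proof.
move=> iJ; elim: k a => [|k IH] a Ja.
  have -> : [set x | ~ J x /\ exists y, x = a * y] = set0;
    last exact: finite_set0.
  by rewrite -subset0 => x [nJ [y xE]]; apply: nJ; rewrite xE hcomm; exact: iJ.
have aaE : pow (a * a) (2 ^ k) = pow a (2 ^ k.+1).
  by rewrite expnS powM ?expn_gt0.
have := IH (a * a); rewrite aaE => /(_ Ja) fin.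
pose J' := J `|` [set x | exists y, x = (a * a) * y].
have iJ' : semigroup_ideal J'.
  by apply: semigroup_idealU => // b _ [y ->]; exists (b * y); rewrite mulgCA.
have J'0 : J' !=set0 by exists (pow a (2 ^ k.+1)); left.
have fin' : finite_set [set x | ~ J' x /\ exists y, x = a * y].
  apply: (squares iJ' J'0) => [x [] //|_ _ [_ [y ->]] [_ [z ->]]].
  by right; exists (y * z); rewrite mulgACA.
have : finite_set ([set x | ~ J' x /\ exists y, x = a * y] `|`
    [set x | ~ J x /\ exists y, x = a * a * y]) by rewrite finite_setU.
apply: sub_finite_set => x [nJx xE].
case: (pselect (exists y, x = a * a * y)) => h; first by right.
by left; split => // -[].
Qed.

(** By [squares] finitely many elements of [T] lie outside [J] and [T^2]. Every element of [T \ J]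
    is one of them or a multiple of one, since splitting it forever would give infinitely many
    prefixes in one principal ideal, and such ideals are finite outside [J]. *)
Lemma nil_ideal_finite (J T : set X) : semigroup_ideal J -> semigroup_ideal T ->
    J !=set0 -> J `<=` T -> (forall a, T a ->
      exists2 n, (0 < n)%N & J (pow a n)) ->
  finite_set (T `\` J).
Proof.
move=> iJ iT J0 JT nil.
have iJr a b : J a -> J (a * b) by rewrite hcomm; exact: iJ.
have principal a : T a -> finite_set [set x | ~ J x /\ exists y, x = a * y].
  move=> /nil[n n0 Jn]; apply: (@nil_principal_finite J n) => //.
  have n2 : (n < 2 ^ n)%N by rewrite ltn_expl.
  by rewrite -(subnKC (ltnW n2)) powD ?subn_gt0 //; exact: iJr.
pose J' := J `|` [set x | exists a b, [/\ T a, T b & x = a * b]].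
have iJ' : semigroup_ideal J'.
  apply: semigroup_idealU => // c _ [a [b [Ta Tb ->]]]; exists (c * a), b.
  by split => //; [exact: iT|rewrite mulgA].
have J'0 : J' !=set0 by case: J0 => j Jj; exists j; left.
pose S := T `\` J'.
have Sfin : finite_set S.
  apply: (squares iJ' J'0) => [x []//|a b [Ta _] [Tb _]].
  by right; exists a, b.
pose div t := exists2 s, S s & t = s \/ exists y, t = s * y.
have bad_step t : T t -> ~ J t -> ~ div t -> exists u v,
    [/\ T u, T v, ~ J v, ~ div v & t = u * v].
  move=> Tt nJt ndt; have J't : J' t.
    by apply: contrapT => nJ't; apply: ndt; exists t; [|left].
  case: J't => [//|[u [v [Tu Tv tE]]]]; exists u, v; split => //.
    by move=> Jv; apply: nJt; rewrite tE; exact: iJ.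
  move=> [s Ss [vs|[y vs]]]; apply: ndt; exists s => //; right.
    by exists u; rewrite tE vs hcomm.
  by exists (u * y); rewrite tE vs mulgCA.
have alldiv t : T t -> ~ J t -> div t.
  move=> Tt nJt; apply: contrapT => ndt.
  pose bad (v : X * X) := [/\ T v.1, T v.2, ~ J v.2 & ~ div v.2].
  pose St := {v : X * X | bad v}.
  pose r (s s' : St) := (sval s).2 = (sval s').1 * (sval s').2.
  have rex s : {s' | r s s'}.
    apply: cid; case: s => -[u v] [/= Tu Tv nJv ndv].
    have [u' [v' [Tu' Tv' nJv' ndv' vE]]] := bad_step v Tv nJv ndv.
    have h : bad (u', v') by split.
    by exists (exist bad _ h).
  have h0 : bad (t, t) by split.
  have [g [g0 gS]] := dependent_choice rex (exist bad _ h0).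
  pose u i := (sval (g i.+1)).1; pose v i := (sval (g i)).2.
  have vS i : v i = u i * v i.+1 by exact: gS.
  have Tu i : T (u i) by have [] := svalP (g i.+1).
  have nJv i : ~ J (v i) by have [] := svalP (g i).
  pose w := fix w i := if i is i.+1 then w i * u i.+1 else u 0%N.
  have wv i : v 0%N = w i * v i.+1.
    elim: i => [|i IH]; first exact: vS.
    by rewrite IH /= vS mulgA.
  have wJ i : ~ J (w i) by move=> Jw; apply: (nJv 0%N); rewrite (wv i);
    exact: iJr.
  have wu i : (exists y, w i.+1 = u 0%N * y).
    elim: i => [|i [y IH]]; first by exists (u 1%N).
    by exists (y * u i.+2); rewrite -[w i.+2]/(w i.+1 * u i.+2) IH mulgA.
  have wle i j : (i < j)%N -> exists2 n, T n & w j = w i * n.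
    elim: j => // j IH; rewrite ltnS leq_eqVlt => /orP[/eqP->|/IH[n Tn wn]].
      by exists (u j.+1).
    by exists (n * u j.+1); [exact: iT|rewrite /= wn mulgA].
  have winj : injective (fun i => w i.+1).
    suff key i j : (i < j)%N -> w i <> w j.
      move=> i j wij; case: (ltngtP i j) => // ij;
        last by case: (key j.+1 i.+1 ij).
      by case: (key i.+1 j.+1 ij).
    (* [w i = w i * n] iterates to [w i = w i * n^k], and some power of [n] lies in [J]. *)
    move=> ij; have [n Tn wn] := wle i j ij; rewrite wn => wE.
    have [k k0 Jk] := nil n Tn; apply: (wJ i).
    suff -> : w i = w i * pow n k by exact: iJ.
    case: k k0 Jk => // k _ _; elim: k => [|k IH]; first exact: wE.
    by rewrite powS // mulgA -wE.
  apply: (sequence_infinite _ winj (principal _ (Tu 0%N))) => i; split;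
    first exact: wJ.
  exact: wu.
apply: (@sub_finite_set _ _ (S `|` \bigcup_(s in S) [set x | ~ J x /\ exists y,
  x = s * y])).
  move=> t [Tt nJt]; have [s Ss [->|ty]] := alldiv t Tt nJt; first by left.
  by right; exists s.
rewrite finite_setU; split => //; apply: bigcup_finite => // s [Ts _].
exact: principal.
Qed.

Hypothesis periodic : forall x : X, exists2 n,
  (0 < n)%N & pow x n * pow x n = pow x n.

(** Modulo [J], which holds the units and all elements that [e] sends to non-units, the proper roots
    of units are nilpotent. *)
Lemma unit_root_finite (e : X) : e * e = e ->
  finite_set [set a | ~ units e a /\ exists2 n, (0 < n)%N & units e (pow a n)].
Proof.
move=> ee.
pose J : set X := [set a | units e (a * e) -> units e a].
pose T : set X := [set a | units e (a * e) ->
  exists2 n, (0 < n)%N & units e (pow a n)].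
have ute a b : units e a -> units e (b * e) -> units e (b * a).
  move=> ua ub; have [ae _] := ua.
  by rewrite -ae hcomm -mulgA (hcomm e); exact: unitM.
have iJ : semigroup_ideal J.
  by move=> a b Jb /(unit_mulP hcomm _ _ ee)[ua /Jb ub]; exact: ute.
have iT : semigroup_ideal T.
  move=> a b Tb /(unit_mulP hcomm _ _ ee)[ua /Tb[n n0 ub]]; exists n => //.
  by rewrite powMl //; apply: ute => //; apply/unit_powP.
apply: (sub_finite_set _ (nil_ideal_finite iJ iT _ _ _)).
- move=> a [nua [n n0 un]]; split; first by exists n.
  apply: contra_not nua; apply; rewrite -(unit_powP hcomm _ ee n0).
  by have [-> _] := un.
- by exists e => _; exact: unit_id.
- by move=> a Ja /Ja ua; exists 1%N.
- move=> a Ta; case: (pselect (units e (a * e))) => [/Ta[n n0 un]|nu];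
  first by exists n.
  by exists 1%N.
Qed.

(** It remains to bound the number of idempotents with proper roots. On an infinite antichain of
    them, products of distinct [z i] are units at no [e k], so the infinite set of all [z i] squares
    into [J]. *)
Lemma clifford_finite_of_squares : clifford_plus_finite X.
Proof.
pose root (e a : X) := exists2 n, (0 < n)%N & units e (pow a n).
have rootex a : exists2 e, e * e = e & root e a.
  have [n n0 an] := periodic a; exists (pow a n) => //; exists n => //;
    exact: unit_id.
pose E : set X := [set e | e * e = e /\ exists a, ~ units e a /\ root e a].
suff Efin : finite_set E.
  apply: (@sub_finite_set _ _ (\bigcup_(e in E) [set a | ~ units e a /\ root e
    a])).
    move=> a na; have [e ee ra] := rootex a.
    have nu : ~ units e a by move=> ua; apply: na; apply/clifford_partP => //;
      exists e.
    by exists e => //; split => //; exists a.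
  by apply: bigcup_finite => // e [ee _]; exact: unit_root_finite.
apply: contrapT => Einf; have [t [tE tinj]] := infinite_sequence Einf.
have tt n : t n * t n = t n by have [] := tE n.
have [|g [_ ganti]] := antichain_sequence tt.
  by move=> n; apply: (sub_finite_set _ (finite_set1 n)) => m /tinj.
pose e i := t (g i).
have ee i : e i * e i = e i by exact: tt.
(* The last power of a proper root before its powers enter the maximal subgroup of [e i]. *)
have /choice[z zP] : forall i, exists z, [/\ ~ units (e i) z,
    units (e i) (z * e i) & units (e i) (z * z)].
  move=> i; have [_ [a [na ra]]] := tE (g i); rewrite -/(e i) in na ra.
  have [n n0 un] := ra.
  have uae : units (e i) (a * e i).
    by rewrite -(unit_powP hcomm _ (ee i) n0); have [-> _] := un.
  have upS k : (0 < k)%N -> units (e i) (pow a k) -> units (e i) (pow a k.+1).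
    move=> k0 uk; rewrite powS //; have [<- _] := uk.
    by rewrite mulgCA // hcomm; exact: unitM.
  have upge k l : (0 < k)%N -> (k <= l)%N -> units (e i) (pow a k) ->
    units (e i) (pow a l).
    move=> k0 /subnK <- uk; elim: (l - k)%N => // d IH.
    by rewrite addSn; apply: upS; rewrite ?addn_gt0 ?k0 ?orbT.
  pose p k := `[< units (e i) (pow a k.+1) >].
  have exp : exists k, p k by exists n.-1; apply/asboolP; rewrite prednK.
  case: (ex_minnP exp) => -[/asboolP//|k] /asboolP pk kmin.
  exists (pow a k.+1); split.
  - by move=> uk; have := kmin k; rewrite ltnn => h;
    have /h : p k by apply/asboolP.
  - by apply/unit_powP.
  - by rewrite -powD //; apply: upge pk => //; lia.
pose J : set X := [set a | forall i, units (e i) (a * e i) -> units (e i) a].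
have key i j : units (e j) (z i * e j) -> i = j.
  move=> uij; have [_ _ uzz] := zP i; apply: ganti; rewrite -/(e i) -/(e j).
  by apply: (unit_le hcomm (ee j) (ee i) uzz); apply/unit_mulP.
apply: (@sequence_infinite _ (range z) z).
- by move=> i; exists i.
- move=> i j zij; symmetry; apply: key; rewrite -zij.
  by have [] := zP i.
- apply: (squares (J := J)).
  + move=> a b Jb i /(unit_mulP hcomm _ _ (ee i))[ua /Jb ub].
    by have [be _] := ub; rewrite -be mulgCA // hcomm; exact: unitM.
  + exists (z 0%N * z 0%N) => i.
    move=> /(unit_mulP hcomm _ _ (ee i))[/key <- _].
    by have [] := zP 0%N.
  + by move=> _ [i _ <-] Ji; have [nz uz _] := zP i; exact/nz/Ji.
  + move=> _ _ [i _ <-] [j _ <-] k /(unit_mulP hcomm _ _ (ee k))[/key ik /key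
    jk].
    by rewrite ik jk; have [] := zP k.
Qed.

End CliffordFinite.

(** * Residual finiteness *)

Section FiniteQuotients.
Variable X : semigroupType.
Hypothesis hcomm : commutative (@mul X).
Hypothesis units_finite : forall e : X, e * e = e -> finite_set (units e).
Hypothesis clifford_finite : clifford_plus_finite X.

(* A congruence has finitely many classes exactly when every ultrafilter
   contains one of them. *)
Definition finite_congruence (R : X -> X -> Prop) :=
  semigroup_congruence R /\
  forall q : set_system X, UltraFilter q -> exists a, q (R a).

Lemma finite_congruenceI R R' : finite_congruence R -> finite_congruence R' ->
  finite_congruence (fun a b => R a b /\ R' a b).
Proof.
move=> [cR fR] [cR' fR']; split.
  split.
  - by move=> a; split; [exact: (congruence_refl cR)|exact: (congruence_refl
    cR')].
  - by move=> a b [h h']; split; [exact: (congruence_sym cR)|exact: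
    (congruence_sym cR')].
  - move=> a b c [h h'] [k k']; split; first exact: (congruence_trans cR) h k.
    exact: (congruence_trans cR') h' k'.
  - move=> a a' b b' [h h'] [k k']; split; first exact: (congruence_mul cR).
    exact: (congruence_mul cR').
move=> q Uq; have [a qa] := fR q Uq; have [b qb] := fR' q Uq.
have [c [ac bc]] := filter_ex (filterI qa qb); exists c.
apply: filterS (filterI qa qb) => d [ad bd]; split.
  exact: (congruence_trans cR) (congruence_sym cR ac) ad.
exact: (congruence_trans cR') (congruence_sym cR' bc) bd.
Qed.

Lemma unit_part_finite (e : X) : e * e = e ->
  finite_congruence (fun a b => unit_part e a = unit_part e b).
Proof.
move=> ee; split; first exact: unit_part_congruence.
move=> q Uq; have [qu|qu] := in_ultra_setVsetC [set a | units e (a * e)] Uq.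
  have [c uc qc] := ultra_finite (f := fun a => a * e) (units_finite ee) qu.
  have [a ac] := filter_ex qc; exists a; apply: filterS qc => b bc.
  have E d : d * e = c -> unit_part e d = Some c.
    by move=> dc; apply/unit_part_some.
  by rewrite (E a ac) (E b bc).
have [a na] := filter_ex qu; exists a; apply: filterS qu => b nb.
have E d : ~ units e (d * e) -> unit_part e d = None by move=> nd;
  apply/unit_part_none.
by rewrite (E a na) (E b nb).
Qed.

Lemma clifford_partM (a b : X) : clifford_part a -> clifford_part b ->
  clifford_part (a * b).
Proof.
rewrite !clifford_partP // => -[e ee [ae [a' aa']]] [f ff [bf [b' bb']]].
exists (e * f); first by rewrite mulgACA // ee ff.
split; first by rewrite mulgACA // ae bf.
by exists (a' * b'); rewrite mulgACA // aa' bb'.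
Qed.

(** In the commutative case, the coarsest congruence for which [[set a]] is a union of classes;
    [None] is the empty context. *)
Definition syntactic_congruence (a u v : X) :=
  forall z : option X, act z u = a <-> act z v = a.

(* If [u] lies in the Clifford part then [z * u] can only equal [a] for one of
   the finitely many [z] outside it, so there are finitely many classes. *)
Lemma syntactic_finite a : ~ clifford_part a ->
  finite_congruence (syntactic_congruence a).
Proof.
move=> na.
have cR : semigroup_congruence (syntactic_congruence a).
  split.
  - by move=> u z.
  - by move=> u v uv z; split => /uv.
  - by move=> u v w uv vw z; split => [/uv/vw|/vw/uv].
  - have E z u v : act z (u * v) = act (Some (act z u)) v.
      by case: z => [z|] //=; rewrite mulgA.
    move=> u u' v v' uu vv z; rewrite E (vv _) -E.
    by rewrite (hcomm u v') E (uu _) -E (hcomm v' u').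
split=> // q Uq.
have [qH|qN] := in_ultra_setVsetC (@clifford_part X) Uq; last first.
  have [c _ qc] := ultra_mem_finite clifford_finite qN.
  by exists c; apply: filterS qc => d /= -> z.
pose D : set (option X) := [set None] `|` (Some @` (~` (@clifford_part X))).
have Dfin : finite_set D.
  by rewrite finite_setU; split; [exact: finite_set1|exact: finite_image].
pose A z : set X := [set u | act z u = a <-> q [set u' | act z u' = a]].
have qA z : D z -> q (A z).
  move=> _; have [qz|qz] := in_ultra_setVsetC [set u' | act z u' = a] Uq.
    by apply: filterS (qz) => u uz; split.
  apply: filterS (qz) => u uz; split => // qz'.
  by exfalso; apply: (filter_disjoint qz qz').
have qD : q [set u | forall z, D z -> A z u] by exact: filter_finite_bigcap.
have [u0 [H0 D0]] := filter_ex (filterI qH qD); exists u0.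
apply: filterS (filterI qH qD) => u [Hu Du] z.
case: (pselect (D z)) => Dz; first exact: iff_trans (D0 z Dz) (iff_sym (Du z
  Dz)).
case: z Dz => [z|] Dz; last by case: Dz; left.
have Hz : clifford_part z by apply: contrapT => nz; apply: Dz; right; exists z.
by split=> /= za; case: na; rewrite -za; exact: clifford_partM.
Qed.

(** For [a] in [H_e] and [b] in [H_f], agreement under both [unit_part] maps gives [b * e = a] and
    [a * f = b], hence [a = b]; elements outside the Clifford part have their syntactic
    congruence. *)
Lemma residually_finite a b : a <> b ->
  exists2 R, finite_congruence R & ~ R a b.
Proof.
move=> ab.
case: (pselect (clifford_part a)) => [/clifford_partP|] Ha; last first.
  exists (syntactic_congruence a); first exact: syntactic_finite.
  by move=> /(_ None) /= [h _]; apply: ab; rewrite h.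
case: (pselect (clifford_part b)) => [/clifford_partP|] Hb; last first.
  exists (syntactic_congruence b); first exact: syntactic_finite.
  by move=> /(_ None) /= [_ h]; apply: ab; rewrite h.
have [e ee ua] := Ha hcomm; have [f ff ub] := Hb hcomm.
apply: contrapT => nR.
have same g : g * g = g -> unit_part g a = unit_part g b.
  move=> gg; apply: contrapT => h; apply: nR.
  by exists (fun a b => unit_part g a = unit_part g b) => //;
    exact: unit_part_finite.
have [ae _] := ua; have [bf _] := ub.
have ea : unit_part e a = Some a by apply/unit_part_some; rewrite ae.
have fb : unit_part f b = Some b by apply/unit_part_some; rewrite bf.
move: ea; rewrite same // => /unit_part_some[_ bea].
move: fb; rewrite -same // => /unit_part_some[_ afb].
by apply: ab; rewrite -[LHS]bea -afb mulgAC // ae.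
Qed.

End FiniteQuotients.

(** * Boundedness *)

Section Bounded.
Variables (C : topSemigroupType -> Prop) (X : semigroupType).
Hypothesis hTz : forall Y : topSemigroupType, TzS Y -> C Y.
Hypothesis hcomm : commutative (@mul X).
Hypothesis inj : injectively_C_closed C X.
Hypothesis chainX : chain_finite X.
Hypothesis units_finite : forall e : X, e * e = e -> finite_set (units e).
Hypothesis clifford_finite : clifford_plus_finite X.
Hypothesis periodic : forall x : X, exists2 n,
  (0 < n)%N & pow x n * pow x n = pow x n.

Section UnboundedAntichain.
Variables (e x : nat -> X).
Hypothesis ee : forall i, e i * e i = e i.
Hypothesis ux : forall i, units (e i) (x i).
Hypothesis anti : forall i j, e i * e j = e j -> i = j.
Hypothesis xpow : forall i n, (0 < n)%N -> (n <= 2 ^ i)%N ->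
  pow (x i) (n * i`!) <> e i.

Definition above i a := units (e i) (a * e i).

(* Elements that vanish at every [e j] except [e i], where they equal [x i ^ m]
   up to the elements of exponent [i!], so that every fixed [a] in [X] acts
   trivially on these cosets for large [i]. *)
Definition degree i m : set X := [set a | (forall j, above j a -> j = i) /\
  exists g, [/\ units (e i) g, pow g i`! = e i & a * e i = pow (x i) m * g]].

Definition zeros : set X := [set a | forall i, ~ above i a].

(** Basic neighbourhoods of a new zero; [2 <= m] keeps the sets of degree one outside. *)
Definition low_degree k : set X := [set a | zeros a \/
  exists i m, [/\ (k <= i)%N, (2 <= m)%N,
    (m * 2 ^ k <= 2 ^ i)%N & degree i m a]].

Lemma aboveM i a b : above i (a * b) <-> above i a /\ above i b.
Proof. exact: unit_mulP. Qed.

Lemma degree_above i m a : (0 < m)%N -> degree i m a -> above i a.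
Proof.
by move=> m0 [_ [g [ug _ aE]]]; rewrite /above aE; apply: unitM => //;
  exact: unit_pow.
Qed.

Lemma zerosM a b : zeros a -> zeros (a * b).
Proof. by move=> Za i /aboveM[/Za]. Qed.

Lemma degreeM i m l a b : (0 < m)%N -> (0 < l)%N -> degree i m a ->
  degree i l b ->
  degree i (m + l) (a * b).
Proof.
move=> m0 l0 [da [g [ug gi ag]]] [_ [h [uh hi bh]]]; split.
  by move=> j /aboveM[/da].
exists (g * h); split; first exact: unitM.
  by rewrite powMl // gi hi ee.
by rewrite powD // mulgACA // -ag -bh mulgACA // ee.
Qed.

Lemma degree_neq i j m l a b : i <> j -> degree i m a -> degree j l b ->
  zeros (a * b).
Proof. by move=> ij [da _] [db _] k /aboveM[/da ki /db kj]; apply: ij;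
  rewrite -ki kj. Qed.

(** An element of both degrees would make the power [m - 1] of [x i] a quotient of two elements of
    exponent [i!], against [xpow]. *)
Lemma degree_disjoint i j m a : (1 < m)%N -> (m <= 2 ^ j)%N ->
  degree i 1 a -> ~ degree j m a.
Proof.
move=> m1 mj da1 dam; have m0 := ltnW m1.
have [_ [g [ug gi ag]]] := da1; have ji := da1.1 _ (degree_above m0 dam).
subst j; have [_ [h [uh hi ah]]] := dam.
have [ge _] := ug; have [he _] := uh.
have m'0 : (0 < m.-1)%N by rewrite -ltnS prednK.
have gE : g = pow (x i) m.-1 * h.
  apply: (unit_cancel hcomm (ux i)) => //; first by rewrite -mulgA he.
  by rewrite mulgA -powS // prednK // -ah ag.
apply: (xpow (i := i) m'0); first exact: leq_trans (leq_pred m) mj.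
have [pe _] := unit_pow hcomm (fact_gt0 i) (unit_pow hcomm m'0 (ux i)).
by rewrite powM ?fact_gt0 // -gi gE powMl // hi pe.
Qed.

(** The factor [a * e i] has exponent [k <= i], hence exponent [i!], and is absorbed by [g]: this is
    what the factorial is for. *)
Lemma degree_mul_above a i m b k : (0 < k)%N -> pow a k * pow a k = pow a k ->
  (k <= i)%N -> above i a -> degree i m b -> degree i m (a * b).
Proof.
move=> k0 ak ki ua [db [g [ug gi bg]]]; split; first by move=> j /aboveM[_ /db].
exists (a * e i * g); split; first exact: unitM.
  have aki : pow (a * e i) k = e i.
    apply: unit_pow_idem => //.
    by rewrite powMl // (pow_idem k (ee i)) mulgACA // ak ee.
  have aii : pow (a * e i) i`! = e i.
    rewrite -{2}aki; apply: pow_idem_dvd; rewrite ?fact_gt0 ?aki ?ee //.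
    by apply: dvdn_fact; rewrite k0.
  by rewrite powMl // gi aii ee.
by rewrite -{1}(ee i) mulgACA // bg mulgCA.
Qed.

Lemma degree_mul_notabove a i m b : ~ above i a -> degree i m b ->
  zeros (a * b).
Proof. by move=> na [db _] j /aboveM[ja /db ji]; apply: na; rewrite -ji. Qed.

Lemma degree_x i : degree i 1 (x i).
Proof.
split; last first.
  by exists (e i); split => //; [exact: unit_id|rewrite pow_idem].
by move=> j uj; symmetry; apply: anti; exact: (unit_le hcomm (ee j) (ee i) (ux
  i)).
Qed.

Lemma zeros_ex : zeros !=set0.
Proof.
exists (x 0%N * x 1%N); apply: (@degree_neq 0 1 1 1) => //; exact: degree_x.
Qed.

Lemma low_degree_le k l : (k <= l)%N -> low_degree l `<=` low_degree k.
Proof.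
move=> kl a [Za|[i [m [li m2 mi da]]]]; [by left|right; exists i, m;
  split => //].
  exact: leq_trans li.
by apply: leq_trans mi; rewrite leq_mul2l leq_exp2l // kl orbT.
Qed.

Lemma low_degreeM k a b : low_degree k.+1 a -> low_degree k.+1 b ->
  low_degree k (a * b).
Proof.
move=> [Za|[i [m [ki m2 mi da]]]]; first by left; exact: zerosM.
move=> [Zb|[j [l [kj l2 lj db]]]]; first by left; rewrite hcomm; exact: zerosM.
case: (pselect (i = j)) => ij; last by left; exact: degree_neq da db.
subst j; right; exists i, (m + l)%N; split.
- exact: ltnW.
- by rewrite (leq_trans m2) ?leq_addr.
- by move: mi lj; rewrite expnS; nia.
- by apply: degreeM => //; exact: ltnW.
Qed.

Lemma low_degree1M k i a b : low_degree k.+1 a -> degree i 1 b ->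
  low_degree k (a * b).
Proof.
move=> [Za|[j [m [kj m2 mj da]]]] db; first by left; exact: zerosM.
case: (pselect (j = i)) => ij; last by left; exact: degree_neq da db.
subst j; right; exists i, (m + 1)%N; split.
- exact: ltnW.
- by rewrite addn1 ltnW.
- by move: mj; rewrite expnS; nia.
- by apply: degreeM => //; exact: ltnW.
Qed.

Lemma degree1M k i j a b : (k < i)%N -> degree i 1 a -> degree j 1 b ->
  low_degree k (a * b).
Proof.
move=> ki da db; case: (pselect (i = j)) => ij; last by left;
  exact: degree_neq da db.
subst j; right; exists i, 2%N; split => //; first exact: ltnW.
  by rewrite -expnS leq_exp2l.
exact: (@degreeM i 1 1).
Qed.

Lemma low_degree_mul a n k b : (0 < n)%N -> pow a n * pow a n = pow a n ->
  (n <= k)%N -> low_degree k b -> low_degree k (a * b).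
Proof.
move=> n0 an nk [Zb|[i [m [ki m2 mi db]]]]; first by left; rewrite hcomm;
  exact: zerosM.
case: (pselect (above i a)) => ua; last by left; exact: degree_mul_notabove db.
right; exists i, m; split => //; apply: (degree_mul_above n0 an) => //.
exact: leq_trans nk ki.
Qed.

Lemma low_degree_disjoint k i a : degree i 1 a -> ~ low_degree k a.
Proof.
move=> da [Za|[j [m [kj m2 mj dam]]]]; first by apply: (Za i);
  exact: degree_above da.
apply: (@degree_disjoint i j m a) => //.
by apply: leq_trans mj; rewrite leq_pmulr // expn_gt0.
Qed.

Variable U : set_system nat.
Hypothesis UU : UltraFilter U.
Hypothesis Ufree : forall D, finite_set D -> ~ U D.

(** Two new points: a zero, to which all members of [zeros] collapse, and the limit along [U] of the
    sets of degree one. The latter squares to the zero, as degree two is low for large [i]. *)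
Definition zero_filter : set_system X := [set A | exists k,
  low_degree k `<=` A].
Definition degree1_filter : set_system X := [set A | U [set i | degree i 1 `<=`
  A]].
Definition new_filters : set (set_system X) :=
  [set F | F = zero_filter \/ F = degree1_filter].

Lemma new_filters_proper F : new_filters F -> ProperFilter F.
Proof.
move=> [->|->].
  apply: Build_ProperFilter_ex.
    by move=> A [k WA]; have [a Za] := zeros_ex; exists a; apply: WA; left.
  split; first by exists 0%N.
    move=> A A' [k WA] [l WA']; exists (maxn k l) => a Wa; split.
      by apply: WA; apply: low_degree_le Wa; exact: leq_maxl.
    by apply: WA'; apply: low_degree_le Wa; exact: leq_maxr.
  by move=> A A' AA' [k WA]; exists k; exact: subset_trans AA'.
apply: Build_ProperFilter_ex.
  move=> A UA; have [i iA] := filter_ex (UA : U [set i | degree i 1 `<=` A]).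
  by exists (x i); apply: iA; exact: degree_x.
split; rewrite /degree1_filter /=.
- by apply: (@filterS _ U _ setT) => //; exact: filterT.
- move=> A A' UA UA'; apply: (@filterS _ U) (@filterI _ U _ _ _ UA UA') =>
  i [iA iA'] a da.
  by split; [exact: iA|exact: iA'].
- by move=> A A' AA' UA; apply: (@filterS _ U) UA => i; move/subset_trans;
  apply.
Qed.

Lemma eq_congruence : semigroup_congruence (@eq X).
Proof. by apply: (@kernel_congruence X X id) => ? ? ? ? -> ->. Qed.

Local Notation sets := (decidable_sets eq new_filters).
Local Notation filters := (extended_filters new_filters).

Lemma sets_of A : zero_filter A \/ zero_filter (~` A) ->
  degree1_filter A \/ degree1_filter (~` A) -> sets A.
Proof. by move=> h1 h2; split=> [a b ->//|_ [->|->]]. Qed.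

Lemma sets_low_degree k : sets (low_degree k).
Proof.
apply: sets_of; first by left; exists k.
right; apply: (@filterS _ U _ setT) filterT => i _ a.
exact: low_degree_disjoint.
Qed.

Lemma sets_degree1 I : U I -> sets [set a | exists2 i, I i & degree i 1 a].
Proof.
move=> UI; apply: sets_of.
  by right; exists 0%N => a Wa [i _ da]; exact: (low_degree_disjoint da Wa).
by left; apply: (@filterS _ U) UI => i Ii a da; exists i.
Qed.

Lemma degree1_filterT I : U I -> degree1_filter [set a | exists2 i,
  I i & degree i 1 a].
Proof. by move=> UI; apply: (@filterS _ U) UI => i Ii a da; exists i. Qed.

Lemma notzero_isolated a : ~ zeros a ->
  zero_filter (~` [set a]) /\ degree1_filter (~` [set a]).
Proof.
move=> nZ; have [i ia] : exists i, above i a.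
  by apply: contrapT => h; apply: nZ => i ia; apply: h; exists i.
split.
  exists i.+1 => b Wb ba; rewrite /= in ba; subst b;
    case: Wb => // -[j [m [ij m2 _ [da _]]]].
  by move: ij; rewrite (da i ia) ltnn.
have : U (~` [set i]) by apply: ultra_setC; apply: Ufree; exact: finite_set1.
apply: (@filterS _ U) => j ji b [db _] ba; rewrite /= in ba; subst b.
by apply: ji; rewrite /= (db i ia).
Qed.

Lemma zero_filterE a A : zeros a -> sets A -> A a <-> zero_filter A.
Proof.
move=> Za [_ dA]; split=> [Aa|[k WA]]; last by apply: WA; left.
have [//|[k WA]] := dA zero_filter (or_introl erefl).
by case: (WA a) => //; left.
Qed.

Definition limit_mul (F G : set_system X) := exists2 H, filters H &
  forall A, sets A -> H A -> exists S T,
    [/\ sets S, sets T, F S, G T & forall u v, S u -> T v -> A (u * v)].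

Lemma limit_mulC F G : limit_mul F G -> limit_mul G F.
Proof.
move=> [H FH h]; exists H => // A sA HA; have [S [T [sS sT FS GT ST]]]
  := h A sA HA.
by exists T, S; split => // u v Tu Sv; rewrite hcomm; exact: ST.
Qed.

Lemma limit_mul_congr F F' G : (forall A, sets A -> F' A -> F A) ->
  limit_mul F' G ->
  limit_mul F G.
Proof.
move=> FF [H FH h]; exists H => // A sA HA;
  have [S [T [sS sT FS GT ST]]] := h A sA HA.
by exists S, T; split => //; exact: FF.
Qed.

Lemma filters_zero : filters zero_filter. Proof. by left; left. Qed.
Lemma filters_degree1 : filters degree1_filter. Proof. by left; right. Qed.
Lemma zero_filter_low k : zero_filter (low_degree k). Proof. by exists k. Qed.

Lemma limit_zero_zero : limit_mul zero_filter zero_filter.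
Proof.
exists zero_filter; first exact: filters_zero.
move=> A sA [k WA]; exists (low_degree k.+1), (low_degree k.+1).
split; try exact: sets_low_degree; try exact: zero_filter_low.
by move=> u v Wu Wv; apply: WA; exact: low_degreeM.
Qed.

Lemma limit_zero_degree1 : limit_mul zero_filter degree1_filter.
Proof.
exists zero_filter; first exact: filters_zero.
move=> A sA [k WA]; exists (low_degree k.+1), [set a | exists2 i,
  setT i & degree i 1 a].
split; [exact: sets_low_degree|exact: (sets_degree1 (@filterT _ U _))|exact:
  zero_filter_low| |].
  exact: (degree1_filterT (@filterT _ U _)).
by move=> u v Wu [i _ dv]; apply: WA; exact: low_degree1M dv.
Qed.

Lemma limit_degree1_degree1 : limit_mul degree1_filter degree1_filter.
Proof.
exists zero_filter; first exact: filters_zero.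
move=> A sA [k WA].
have Uk : U [set i | (k < i)%N].
  suff -> : [set i | (k < i)%N] = ~` `I_k.+1 by apply: ultra_setC;
    apply: Ufree; exact: finite_II.
  by rewrite eqEsubset; split => m /=; rewrite ltnS; lia.
exists [set a | exists2 i, [set i | (k < i)%N] i & degree i 1 a],
  [set a | exists2 i, [set i | (k < i)%N] i & degree i 1 a].
split; try exact: sets_degree1; try exact: degree1_filterT.
by move=> u v [i ki du] [j _ dv]; apply: WA; exact: degree1M ki du dv.
Qed.

Lemma sets_singleton a : ~ zeros a -> sets [set a].
Proof. by move=> /notzero_isolated[h1 h2]; apply: sets_of; right. Qed.

Lemma limit_point_zero a : ~ zeros a -> limit_mul (principal_filter a)
  zero_filter.
Proof.
move=> nZ; exists zero_filter; first exact: filters_zero.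
move=> A sA [k WA]; have [n n0 an] := periodic a.
exists [set a], (low_degree (maxn k n)); rewrite principal_filterE.
split; [exact: sets_singleton|exact: sets_low_degree|by []|exact:
  zero_filter_low|].
move=> u v -> Wv; apply: WA; apply: (low_degree_le (leq_maxl k n)).
exact: (low_degree_mul n0 an (leq_maxr k n) Wv).
Qed.

(** If [a] is a unit at [U]-almost all [e i], it fixes the degree one point, its factors being
    absorbed as torsion; otherwise it sends that point to the zero. *)
Lemma limit_point_degree1 a : ~ zeros a ->
  limit_mul (principal_filter a) degree1_filter.
Proof.
move=> nZ; have [n n0 an] := periodic a.
have [Ua|Ua] := in_ultra_setVsetC [set i | above i a] UU.
  exists degree1_filter; first exact: filters_degree1.
  move=> A sA UA; rewrite /degree1_filter /= in UA.
  have Un : U [set i | (n <= i)%N].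
    suff -> : [set i | (n <= i)%N] = ~` `I_n by apply: ultra_setC;
      apply: Ufree; exact: finite_II.
    by rewrite eqEsubset; split => m /=; lia.
  have UI : U ([set i | degree i 1 `<=` A] `&`
      ([set i | above i a] `&` [set i | (n <= i)%N])).
    by apply: filterI => //; exact: filterI.
  exists [set a], [set b | exists2 i, ([set i | degree i 1 `<=` A] `&`
    ([set i | above i a] `&` [set i | (n <= i)%N])) i & degree i 1 b].
  rewrite principal_filterE; split => //;
    [exact: sets_singleton|exact: sets_degree1 UI|exact: degree1_filterT UI|].
  by move=> u v -> [i [iA [ia ni]] dv]; apply: iA;
    exact: (degree_mul_above n0 an).
exists zero_filter; first exact: filters_zero.
move=> A sA [k WA]; exists [set a], [set b | exists2 i,
  (~` [set i | above i a]) i & degree i 1 b].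
rewrite principal_filterE; split => //; [exact: sets_singleton|exact:
  sets_degree1 Ua|exact: degree1_filterT Ua|].
by move=> u v -> [i ia dv]; apply: WA; left; exact: degree_mul_notabove dv.
Qed.

Lemma limit_point_point a b : ~ zeros a -> ~ zeros b ->
  limit_mul (principal_filter a) (principal_filter b).
Proof.
move=> nZa nZb; exists (principal_filter (a * b)); first by right;
  exists (a * b).
move=> A sA; rewrite principal_filterE => Aab; exists [set a], [set b].
rewrite !principal_filterE; split => //; try exact: sets_singleton.
by move=> u v -> ->.
Qed.

(** On [sets] the principal filter of a member of [zeros] agrees with [zero_filter], so three kinds
    of points remain. *)
Lemma filters_cases (K : set_system X -> Prop) :
  (forall F F', (forall A, sets A -> F' A -> F A) -> K F' -> K F) ->
  K zero_filter -> K degree1_filter ->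
  (forall a, ~ zeros a -> K (principal_filter a)) -> forall F, filters F -> K F.
Proof.
move=> Kc K0 K1 Kp F [[->//|->//]|[a ->]].
case: (pselect (zeros a)) => Za; last exact: Kp.
by apply: Kc K0 => A sA; rewrite principal_filterE => /(zero_filterE Za sA).
Qed.

Lemma limit_mul_filters F G : filters F -> filters G -> limit_mul F G.
Proof.
move=> fF fG; move: G fG F fF.
apply: filters_cases => [G G' GG h F fF||| a nZa].
- by apply: limit_mulC; apply: limit_mul_congr GG _; apply: limit_mulC;
  exact: h.
- apply: filters_cases => [F F'|||a nZ].
  + exact: limit_mul_congr.
  + exact: limit_zero_zero.
  + exact/limit_mulC/limit_zero_degree1.
  + exact: limit_point_zero.
- apply: filters_cases => [F F'|||a nZ].
  + exact: limit_mul_congr.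
  + exact: limit_zero_degree1.
  + exact: limit_degree1_degree1.
  + exact: limit_point_degree1.
- apply: filters_cases => [F F'|||b nZb].
  + exact: limit_mul_congr.
  + exact/limit_mulC/limit_point_zero.
  + exact/limit_mulC/limit_point_degree1.
  + exact: limit_point_point.
Qed.

Lemma degree_completion : completion sets filters.
Proof.
have cE := eq_congruence.
split.
- exact: (decidable_setT _ new_filters_proper).
- exact: (decidable_setC cE).
- exact: (decidable_setI new_filters_proper).
- by move=> F [/new_filters_proper//|[a ->]]; exact: principal_filter_proper.
- move=> F A [nF [_ /(_ F nF)]//|[a ->] _].
  by rewrite !principal_filterE; exact: EM.
- by move=> a; right; exists a.
- exact: limit_mul_filters.
Qed.

(** An ultrafilter finer than [degree1_filter] is Cauchy for all finite congruences. A limit in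
    [zeros] is excluded by [low_degree 0], any other one by being isolated. *)
Lemma unbounded_antichain_absurd : False.
Proof.
have FF := new_filters_proper (or_intror erefl).
have [q [Uq Fq]] := ultraFilterLemma FF.
have [|||||a [_ aq]] := @cauchy_point X sets filters (@finite_congruence X)
  degree_completion
   _ _ _ C hTz inj _ q.
- by move=> R [].
- have [R fR _] : exists2 R, finite_congruence (X := X) R & True.
    exists (fun a b => unit_part (e 0%N) a = unit_part (e 0%N) b) => //.
    exact: unit_part_finite.
  by exists R.
- move=> R R' fR fR'; exists (fun a b => R a b /\ R' a b) => //.
  exact: finite_congruenceI.
- by move=> a b; exact: residually_finite.
- split; first exact: ultra_proper.
    by move=> R [_]; exact.
  by exists degree1_filter; [exact: filters_degree1|move=> A _ /Fq].
case: (pselect (zeros a)) => Za.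
  apply: (aq (~` low_degree 0)).
  - exact: (decidable_setC eq_congruence (sets_low_degree 0)).
  - apply: Fq; apply: (@filterS _ U _ setT) filterT => i _ b.
    exact: low_degree_disjoint.
  - by left.
apply: (aq (~` [set a])) => //.
  exact: (decidable_setC eq_congruence (sets_singleton Za)).
by apply: Fq; have [] := notzero_isolated Za.
Qed.

End UnboundedAntichain.

Lemma common_exponent (D : set X) : finite_set D ->
  exists2 K, (0 < K)%N & forall a, D a -> pow a K * pow a K = pow a K.
Proof.
move=> /finite_seqP[s ->]; elim: s => [|a s [K K0 IH]]; first by exists 1%N.
have [n n0 an] := periodic a; exists (n * K)%N; first by rewrite muln_gt0 n0.
move=> b; rewrite /= inE => /orP[/eqP->|/IH bK].
  by rewrite (pow_idem_dvd _ _ an) ?muln_gt0 ?n0 ?dvdn_mulr.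
by rewrite (pow_idem_dvd _ _ bK) ?muln_gt0 ?n0 ?dvdn_mull.
Qed.

Lemma bounded_of_closed : bounded_semigroup X.
Proof.
apply: contrapT => nb.
have nbK L : (0 < L)%N -> exists a : X, pow a L * pow a L <> pow a L.
  move=> L0; apply: contrapT => h; apply: nb; exists L => // a.
  by apply: contrapT => ha; apply: h; exists a.
have [K K0 KN] := common_exponent clifford_finite.
have /choice[ex exP] : forall i, exists p : X * X, [/\ p.1 * p.1 = p.1,
  units p.1 p.2 &
    forall n, (0 < n)%N -> (n <= 2 ^ i)%N -> pow p.2 (n * i`!) <> p.1].
  (* [K] handles the elements outside the Clifford part, and every [n * i!] with [0 < n <= 2 ^ i]
     divides the factorial. *)
  move=> i; pose L := (K * (2 ^ i * i`!)`!)%N.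
  have L0 : (0 < L)%N by rewrite muln_gt0 K0 fact_gt0.
  have [a aL] := nbK L L0.
  have /(clifford_partP hcomm)[f ff ua] : clifford_part a.
    apply: contrapT => /KN aK; apply: aL.
    by rewrite (pow_idem_dvd L0 _ aK) ?dvdn_mulr.
  exists (f, a); split => //= n n0 ni an; apply: aL.
  have m0 : (0 < n * i`!)%N by rewrite muln_gt0 n0 fact_gt0.
  suff h : pow a L = pow a (n * i`!) by rewrite h an ff.
  apply: pow_idem_dvd => //; last by rewrite an ff.
  apply: dvdn_mull; apply: dvdn_fact; rewrite m0 /=.
  by rewrite leq_mul2r ni orbT.
pose e0 i := (ex i).1; pose x0 i := (ex i).2.
have ee0 i : e0 i * e0 i = e0 i by have [] := exP i.
have ux0 i : units (e0 i) (x0 i) by have [] := exP i.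
have xpow0 i n : (0 < n)%N -> (n <= 2 ^ i)%N -> pow (x0 i) (n * i`!) <> e0 i.
  by have [_ _ h] := exP i; exact: h.
have [|g [gmono ganti]] := antichain_sequence hcomm chainX ee0.
  (* A value of [e0] recurs only finitely often: an exponent [M] of its finite maximal subgroup
     divides [m!] once [m >= M]. *)
  move=> n; have [M M0 MP] := common_exponent (units_finite (ee0 n)).
  apply: (sub_finite_set _ (finite_II M)) => m /= mn; rewrite ltnNge;
    apply/negP => Mm.
  apply: (xpow0 m 1%N) => //; first by rewrite expn_gt0.
  have um := ux0 m; rewrite mn in um.
  have xM := unit_pow_idem hcomm M0 um (MP _ um).
  rewrite mul1n mn -xM; apply: pow_idem_dvd; rewrite ?fact_gt0 ?xM ?ee0 //.
  by apply: dvdn_fact; rewrite M0.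
have gi i : (i <= g i)%N.
  by elim: i => // i IH; apply: leq_ltn_trans IH _; exact: gmono.
have [U [UU _ Ufree]] := free_ultrafilter infinite_nat.
apply: (@unbounded_antichain_absurd (e0 \o g) (x0 \o g) _ _ _ _ U UU Ufree)
  => [i|i|i j|i n n0 ni xn]; [exact: ee0|exact: ux0|exact: ganti|].
apply: (xpow0 (g i) n n0).
  by apply: leq_trans ni _; rewrite leq_exp2l.
rewrite /= in xn; rewrite -xn; apply: pow_idem_dvd;
  rewrite ?muln_gt0 ?n0 ?fact_gt0 ?xn ?ee0 //.
rewrite dvdn_pmul2l //; apply: dvdn_trans (_ : (i`! %| (g i)`!)%N) => //.
by rewrite -(bin_fact (gi i)) dvdn_mull // dvdn_mulr.
Qed.

End Bounded.

(** * Closedness of homomorphic images *)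

Section Limits.
Variables (T : Type) (p : set_system T) (Y : topSemigroupType).
Context {pF : ProperFilter p}.

Definition tends (f : T -> Y) (y : Y) := forall O, nbhs y O -> p (f @^-1` O).

Lemma tends_cst y : tends (fun=> y) y.
Proof. by move=> O /nbhs_singleton Oy; apply: filterS filterT => t _. Qed.

Lemma tendsM f g y z : tends f y -> tends g z ->
  tends (fun t => f t * g t) (y * z).
Proof.
move=> fy gz O Oyz; have [[A B] [/= Ay Bz] AB]
  := @mulg_continuous Y (y, z) O Oyz.
apply: filterS (filterI (fy A Ay) (gz B Bz)) => t [At Bt].
exact: (AB (f t, g t)).
Qed.

Lemma tends_pow f y n : tends f y -> tends (fun t => pow (f t) n) (pow y n).
Proof.
move=> fy; case: n => // n; elim: n => // n IH.
have -> : (fun t => pow (f t) n.+2) = (fun t => f t * pow (f t) n.+1) by [].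
by rewrite powS //; exact: tendsM.
Qed.

Lemma tends_eq f g y : p [set t | f t = g t] -> tends f y -> tends g y.
Proof. by move=> fg fy O /fy pO; apply: filterS (filterI fg pO) =>
  t [/= <-]. Qed.

Lemma tends_unique f y z : hausdorff_space Y -> tends f y -> tends f z -> y = z.
Proof.
move=> hY fy fz; apply: hY => A B Ay Bz.
by have [t [At Bt]] := filter_ex (filterI (fy A Ay) (fz B Bz)); exists (f t).
Qed.

End Limits.

Section ClosedImage.
Variable X : semigroupType.
Hypothesis hcomm : commutative (@mul X).
Hypothesis chainX : chain_finite X.

(** An infinite [r]-increasing sequence would be a set in which every product is one of its factors.
    The relation is a parameter because both maximal and minimal idempotents are needed. *)
Lemma chain_extremal (r : X -> X -> Prop) (D : set X) : D !=set0 ->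
    (forall a b c, r a b -> r b c -> r a c) -> (forall a, ~ r a a) ->
    (forall a b, D a -> D b -> r a b -> a * b = a \/ a * b = b) ->
    (forall a, D a -> a * a = a) ->
  exists2 s, D s & forall w, D w -> ~ r s w.
Proof.
move=> [d Dd] rtrans rirr rchain Didem; apply: contrapT => no.
have rex (s : {w | D w}) : {t : {w | D w} | r (sval s) (sval t)}.
  apply: cid; case: s => s Ds /=; apply: contrapT => h; apply: no;
    exists s => //.
  by move=> w Dw sw; apply: h; exists (exist _ w Dw).
have [g [_ gS]] := dependent_choice rex (exist _ d Dd).
pose w i := sval (g i).
have rw i j : (i < j)%N -> r (w i) (w j).
  elim: j => // j IH; rewrite ltnS leq_eqVlt => /orP[/eqP->|/IH];
    first exact: gS.
  by move=> h; exact: rtrans h (gS j).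
have winj : injective w.
  move=> i j ij; case: (ltngtP i j) => // /rw; rewrite ij => /rirr[].
have [x [y [[i _ <-] [j _ <-]]]] := chainX (sequence_infinite (t := w) (A :=
  range w)
  (fun i => ex_intro2 _ _ i I erefl) winj).
have Dw i0 : D (w i0) by exact: svalP (g i0).
apply; case: (ltngtP i j) => [ij|ji|->].
- by case: (rchain _ _ (Dw i) (Dw j) (rw _ _ ij)); [left|right].
- by rewrite hcomm; case: (rchain _ _ (Dw j) (Dw i) (rw _ _ ji)); [right|left].
- by left; exact: Didem.
Qed.

Lemma idempotentM (a b : X) : a * a = a -> b * b = b ->
  (a * b) * (a * b) = a * b.
Proof. by move=> aa bb; rewrite mulgACA // aa bb. Qed.

(** A minimal element of the generated subsemigroup [S] lies below all of [B]; anything below [B] is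
    below all of [S]. *)
Lemma idempotent_inf (B : set X) : B !=set0 -> (forall a, B a -> a * a = a) ->
  exists m, [/\ m * m = m, forall b, B b -> b * m = m &
    forall s, (forall b, B b -> b * s = s) -> m * s = s].
Proof.
move=> B0 Bidem.
pose S : set X := [set w | forall K : set X, B `<=` K ->
  (forall a b, K a -> K b -> K (a * b)) -> K w].
have BS : B `<=` S by move=> b Bb K BK _; exact: BK.
have SM a b : S a -> S b -> S (a * b).
  by move=> Sa Sb K BK KM; apply: (KM); [exact: Sa|exact: Sb].
have Sidem a : S a -> a * a = a.
  move=> Sa; apply: (Sa [set w | w * w = w]) => //= b c; exact: idempotentM.
have [|||||m Sm mmin] := @chain_extremal (fun a b => a * b = b /\ a <> b) S.
- by case: B0 => b /BS; exists b.
- move=> a b c [ab nab] [bc nbc]; split; first by rewrite -bc mulgA ab.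
  by move=> ac; subst c; apply: nab; rewrite -bc hcomm.
- by move=> a [].
- by move=> a b _ _ [ab _]; right.
- exact: Sidem.
exists m; split; first exact: Sidem.
- move=> b Bb; have Sb := BS b Bb; apply: contrapT => nbm.
  apply: (mmin (b * m)); first exact: SM.
  by split; [rewrite mulgCA // Sidem|move=> h; apply: nbm; rewrite -h].
- by move=> s sB; apply: (Sm [set w | w * s = s]) => //= a b as_ bs;
  rewrite -mulgA bs.
Qed.

(** A maximal [s] is the largest: for another [w], the infimum of [f] over the common set lies above
    both, and maximality identifies it with [s]. *)
Lemma ultrafilter_sup (p : set_system X) (f : X -> X) : UltraFilter p ->
    (forall a, f a * f a = f a) ->
  exists s, [/\ s * s = s, p [set a | f a * s = s] &
    forall w, w * w = w -> p [set a | f a * w = w] -> w * s = w].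
Proof.
move=> Up fidem.
have inf A : p A -> exists m, [/\ m * m = m, forall a, A a -> f a * m = m &
    forall s, (forall a, A a -> f a * s = s) -> m * s = s].
  move=> pA; have [||m [mm mB mS]] := @idempotent_inf (f @` A).
  - by have [a Aa] := filter_ex pA; exists (f a), a.
  - by move=> _ [a _ <-].
  - exists m; split => // [a Aa|s sA]; first by apply: mB; exists a.
    by apply: mS => _ [a Aa <-]; exact: sA.
pose D : set X := [set w | w * w = w /\ p [set a | f a * w = w]].
have [|||||s [ss ps] smax] := @chain_extremal (fun a b =>
  a * b = a /\ a <> b) D.
- have [m [mm mA _]] := inf _ filterT; exists m; split => //.
  by apply: filterS filterT => a _; exact: mA.
- move=> a b c [ab nab] [bc nbc]; split; first by rewrite -ab -mulgA bc.
  by move=> ac; subst c; apply: nab; rewrite -ab hcomm.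
- by move=> a [].
- by move=> a b _ _ [ab _]; left.
- by move=> a [].
exists s; split => // w ww pw.
have pi : p ([set a | f a * s = s] `&` [set a | f a * w = w]) by exact: filterI.
have [m [mm mA mS]] := inf _ pi.
have ms : m * s = s by apply: mS => a [].
have mw : m * w = w by apply: mS => a [].
have sm : s = m.
  apply: contrapT => nsm; apply: (smax m); last by split => //; rewrite hcomm.
  by split => //; apply: filterS pi => a; exact: mA.
by rewrite sm hcomm.
Qed.

Lemma closed_image (Y : topSemigroupType) (h : {multiplicative X -> Y}) :
    hausdorff_space Y -> bounded_semigroup X -> group_finite X ->
    clifford_plus_finite X ->
  closed (range h).
Proof.
move=> hY [n n0 bnd] gfin cfin y cly.
pose F : set_system X := [set A | exists2 O, nbhs y O & h @^-1` O `<=` A].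
have FF : ProperFilter F.
  apply: Build_ProperFilter_ex.
    move=> A [O Oy OA]; have [_ [[a _ <-] Oa]] := cly O Oy.
    by exists a; exact: OA.
  split; first by exists setT => //; exact: filterT.
    move=> A A' [O Oy OA] [O' Oy' OA']; exists (O `&` O'); first exact: filterI.
    by move=> a [Oa O'a]; split; [exact: OA|exact: OA'].
  by move=> A A' AA' [O Oy OA]; exists O => //; exact: subset_trans AA'.
have [p [Up Fp]] := ultraFilterLemma FF.
have tc (z : Y) : tends p (fun=> z) z by exact: tends_cst.
have hp : tends p h y by move=> O Oy; apply: Fp; exists O.
have image c g : p [set a | h (g a) = h c] -> tends p (fun a => h (g a)) y ->
  range h y.
  move=> pc lim; exists c => //; apply: (@tends_unique _ p Y _ (fun=> h c) _ _
    hY); first exact: tc.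
  exact: (@tends_eq _ p Y _ (fun a => h (g a)) (fun=> h c) y pc lim).
have [pH|pN] := in_ultra_setVsetC (@clifford_part X) Up; last first.
  have [c _ pc] := ultra_mem_finite cfin pN.
  by apply: (image c id) => //; apply: filterS pc => a /= ->.
pose f (a : X) := pow a n.
have fidem a : f a * f a = f a by exact: bnd.
have [s [ss ps smax]] := ultrafilter_sup Up fidem.
have hpow (a : X) m : h (pow a m) = pow (h a) m.
  by case: m => // m; elim: m => // m IH; rewrite powS // gmulfM IH -powS.
pose e : Y := pow (y : Y) n.
have fe : tends p (fun a => h (f a)) e.
  have -> : (fun a => h (f a)) = (fun a => pow (h a) n) by apply: funext => a;
    exact: hpow.
  exact: tends_pow.
have ee : e * e = e.
  apply: (tends_unique hY (tendsM fe fe)).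
  apply: (tends_eq (f := fun a => h (f a)) _ fe).
  by apply: (@filterS _ p _ setT) filterT => a _ /=; rewrite -gmulfM fidem.
have se : h s * e = h s.
  apply: (tends_unique hY (tendsM (tc (h s : Y)) fe)).
  apply: (tends_eq (f := fun=> h s) _ (tc (h s : Y))).
  apply: (filterS _ ps) => a /= fs.
  by rewrite -gmulfM hcomm fs.
(* Otherwise some open [O] contains [e] but not [h s]. A minimal idempotent [w >= s] with [h w * e]
   in [O] satisfies [w <= f a] for [p]-almost all [a], since [w * f a] qualifies too; so [w = s],
   although [h s * e = h s] is outside [O]. *)
have hs : h s = e.
  apply: contrapT => nse; have /eqP es : e <> h s by move=> es; apply: nse.
  have [O [oO Oe Os]] := hausdorff_accessible hY es.
  rewrite inE in Oe.
  pose D : set X := [set w | [/\ w * w = w, w * s = s & O (h w * e)]].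
  have step w : O (h w * e) -> p [set a | O (h (w * f a) * e)].
    move=> Ow; have lim : tends p (fun a => h w * h (f a) * e) (h w * e * e).
      by apply: tendsM => //; apply: tendsM.
    rewrite -mulgA ee in lim; have := lim O (open_nbhs_nbhs (conj oO Ow)).
    by apply: (@filterS _ p) => a /=; rewrite gmulfM.
  have [|||||w [ww ws Ow] wmin] := @chain_extremal (fun a b =>
    a * b = b /\ a <> b) D.
  - have pO : p [set a | O (h (f a) * e)].
      have lim : tends p (fun a => h (f a) * e) (e * e) by exact: tendsM.
      by rewrite ee in lim; apply: lim; exact: open_nbhs_nbhs.
    by have [a [fs Oa]] := filter_ex (filterI ps pO); exists (f a); split.
  - move=> a b c [ab nab] [bc nbc]; split; first by rewrite -bc mulgA ab.
    by move=> ac; subst c; apply: nab; rewrite -bc hcomm.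
  - by move=> a [].
  - by move=> a b _ _ [ab _]; right.
  - by move=> a [].
  have pO := step w Ow.
  have fw : p [set a | f a * w = w].
    apply: filterS (filterI ps pO) => a [fs Oa] /=.
    apply: contrapT => nfw; apply: (wmin (w * f a)).
      split; [exact: idempotentM|by rewrite -mulgA fs|by []].
    by split; [rewrite mulgA ww|move=> wfa; apply: nfw; rewrite hcomm -wfa].
  have wE := smax w ww fw; rewrite ws in wE.
  by rewrite inE in Os; apply: Os; rewrite -se wE.
(* On the Clifford part [a * f a = a], and this passes to the limit. *)
have ye : y * e = y.
  apply: (tends_unique hY (tendsM hp fe)); apply: (tends_eq (f := h) _ hp).
  apply: (filterS _ pH) => a /(clifford_partP hcomm)[g gg ua] /=.
  rewrite -gmulfM /f (unit_pow_idem hcomm n0 ua (fidem a)).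
  by have [-> _] := ua.
(* From [f a * s = s] it follows that [a * s] is in the finite group [H_s], hence constant on a
   member of [p]. *)
have [|c _ pc] := @ultra_finite _ _ p _ (fun a =>
  a * s) _ (gfin _ (units_subgroup hcomm ss)).
  apply: filterS ps => a /= fs; rewrite -(unit_powP hcomm _ ss n0) -/(f a) fs.
  exact: unit_id.
apply: (image c (fun a => a * s)); first by apply: filterS pc => a /= ->.
have -> : (fun a => h (a * s)) = (fun a => h a * h s) by apply: funext => a;
  exact: gmulfM.
by rewrite -[y]ye -hs; apply: tendsM => //; exact: tc.
Qed.

End ClosedImage.

Lemma absolutely_closed_projectively (C : topSemigroupType ->
  Prop) (X : semigroupType) :
  absolutely_C_closed C X -> projectively_C_closed C X.
Proof.
move=> absX e ce Y h CY _.
pose k : X -> Y := fun a => h (\pi_{eq_quot e} a : quotient_semigroup ce).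
have kM : {morph k : a b / a * b}.
  by move=> a b; rewrite /k -gmulfM; congr (h _); exact: pi_quotient_mul.
pose km := isMultiplicative.Build X Y k kM.
pose K : {multiplicative X -> Y} := HB.pack k km.
suff -> : range h = range K by exact: absX.
rewrite eqEsubset; split => _ [a _ <-]; last by exists (\pi_{eq_quot e} a).
by exists (repr (a : {eq_quot e})) => //=; rewrite /k reprK.
Qed.

Theorem corollary1p13 (C : topSemigroupType -> Prop)
    (hTz : forall Y : topSemigroupType, TzS Y -> C Y)
    (hT2 : forall Y : topSemigroupType, C Y -> T2S Y)
    (X : semigroupType) (hcomm : commutative (@mul X)) :
  (absolutely_C_closed C X <->
     projectively_C_closed C X /\ injectively_C_closed C X) /\
  (absolutely_C_closed C X <->
     [/\ bounded_semigroup X, chain_finite X, group_finite X &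
         clifford_plus_finite X]).
Proof.
have abs_proj_inj : absolutely_C_closed C X ->
    projectively_C_closed C X /\ injectively_C_closed C X.
  move=> absX; split; first exact: absolutely_closed_projectively.
  by move=> Y h CY _; exact: absX.
have conditions : projectively_C_closed C X /\ injectively_C_closed C X ->
    [/\ bounded_semigroup X, chain_finite X,
      group_finite X & clifford_plus_finite X].
  move=> [proj inj].
  have chainX := projectively_closed_chain_finite hTz hcomm proj.
  have periodic := projectively_closed_idempotent_power hTz hcomm proj.
  have ufin (e : X) : e * e = e -> finite_set (units e).
    move=> ee; have [n n0 un] := projectively_closed_units_bounded hTz hcomm
      proj ee.
    apply: sub_finite_set (units_torsion_finite hTz hcomm inj ee n0) => a ua.
    by split => //; exact: un.
  have cfin : clifford_plus_finite X.
    apply: clifford_finite_of_squares => //.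
    exact: (finite_square_in_ideal hTz hcomm proj).
  split => //; first exact: (bounded_of_closed hTz hcomm inj).
  move=> G /subgroup_sub_units[e [ee _ GU]];
    exact: sub_finite_set GU (ufin e ee).
have closed_abs : [/\ bounded_semigroup X, chain_finite X, group_finite X &
    clifford_plus_finite X] -> absolutely_C_closed C X.
  by move=> [bX chainX gX cX] Y h /hT2 TY; exact: closed_image.
split; split => //.
- by move=> /conditions/closed_abs.
- by move=> /abs_proj_inj/conditions.
Qed.
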